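(* Let $(\Omega_i,\Sigma_i,\mu_i)$, $i=1,2$, be two measure spaces, let $1<p<\infty$, and let $X_i=L^p(\Omega_i,\Sigma_i,\mu_i)$. Assume that $f:X_1\to X_2$ is an $\varepsilon$-nearisometry with $f(0)=0$. Then there is a continuous linear operator $T:X_2\to X_1$ with $\|T\|=1$ such that $$\|Tf(x)-x\|\le 2\varepsilon\quad\text{for all }x\in X_1.$$
   Context: All Banach spaces are real, so $L^p$ denotes the space of real-valued $p$-integrable functions. For $\varepsilon\ge 0$, a map $f:X\to Y$ between Banach spaces (not assumed continuous or surjective) is an $\varepsilon$-nearisometry if $|\,\|f(x)-f(y)\|-\|x-y\|\,|\le\varepsilon$ for all $x,y\in X$.
   Formalization: The formal statement assumes in addition that X_1 ≠ {0}; if X_1 = {0}, every operator T from X_2 to X_1 is zero, so ‖T‖ = 1 is impossible. *)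

(* Defs.v *)
From HB Require Import structures.
From mathcomp Require Import all_boot all_order all_algebra.
From mathcomp Require Import all_classical all_reals all_analysis.
From mathcomp Require Import measurable_realfun ess_sup_inf.

Set Implicit Arguments.
Unset Strict Implicit.
Unset Printing Implicit Defensive.

Import Order.TTheory GRing.Theory Num.Theory.
Import numFieldNormedType.Exports.

Local Open Scope classical_set_scope.
Local Open Scope ring_scope.

(* The library type [LspaceType mu p1] of a.e.-classes of measurable functions
   with finite p-norm carries no algebraic or normed structure.  It is made a
   [normedModType R] here, the operations being those of [LfunType] applied to
   representatives and the norm being the p-norm of a representative. *)
Section Lspace_normedModType.
Context d (T : measurableType d) (R : realType).
Context (mu : {measure set T -> \bar R}) (p : \bar R) (p1 : (1 <= p)%E).

Notation Lfn := (LfunType mu p1).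
Notation Lsp := (LspaceType mu p1).
Notation mR := (measurableTypeR R).

HB.instance Definition _ := gen_eqMixin Lsp.
HB.instance Definition _ := gen_choiceMixin Lsp.

Lemma ae_eq_Lnorm (f g : T -> R) :
  measurable_fun setT f -> measurable_fun setT g -> f = g %[ae mu] ->
  'N[mu]_p[EFin \o f]%E = 'N[mu]_p[EFin \o g]%E.
Proof.
have mpowR r (h : T -> R) : measurable_fun setT h ->
    measurable_fun setT (fun x => h x `^ r).
  exact: (@measurableT_comp _ _ _ _ _ _ (@powR R ^~ r)).
move=> mf mg fg; rewrite unlock /Lnorm; case: p p1 => [r r1|_|//].
- congr (_ `^ _)%E; apply: ae_eq_integral => //.
  + exact/measurable_EFinP/mpowR/measurableT_comp.
  + exact/measurable_EFinP/mpowR/measurableT_comp.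
  + by apply: filterS fg => x + _ => /(_ I) /= ->.
- case: ifPn => // _; apply: eq_ess_sup.
  by apply: filterS fg => x /(_ I) /= ->.
Qed.

Local Open Scope quotient_scope.

(* [LspaceType] is built on functions into [measurableTypeR R] whereas
   [LfunType] is built on functions into [R]: same carrier and sigma-algebra,
   but distinct displays. *)
Lemma Lrepr_subproof (f : Lsp) : (f : T -> R) \in Lfun mu p.
Proof.
rewrite inE; apply/andP; split; apply: mem_set.
  exact: (@measurable_funPT _ _ _ _ (repr (f : {mfun_ mu, T >-> mR}))).
exact: (@Lebesgue_finite _ _ _ _ _ _ f).
Qed.

Definition Lrepr (f : Lsp) : Lfn := Lfun_Sub p1 (Lrepr_subproof f).

Lemma Lclass_mfun_subproof (f : Lfn) : (f : T -> mR) \in mfun.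
Proof. by apply: mem_set; exact: (@measurable_funPT _ _ _ _ f). Qed.

Definition Lclass_quot (f : Lfn) : {mfun_ mu, T >-> mR} :=
  \pi_({mfun_ mu, T >-> mR})
    (mfun_Sub (Lclass_mfun_subproof f) : {mfun T >-> mR}).

Lemma repr_Lclass_quot (f : Lfn) :
  (Lclass_quot f : T -> R) = (f : T -> R) %[ae mu].
Proof. by have /eqmodP/asboolP := reprK (Lclass_quot f). Qed.

Lemma Lclass_subproof (f : Lfn) : finite_norm mu p (Lclass_quot f : T -> R).
Proof.
rewrite /finite_norm.
have mr : measurable_fun [set: T] (Lclass_quot f : T -> R).
  exact: (@measurable_funPT _ _ _ _ (repr (Lclass_quot f))).
rewrite (ae_eq_Lnorm mr (measurable_funPT f) (repr_Lclass_quot f)).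
exact: Lfunction_finite.
Qed.

Definition Lclass (f : Lfn) : Lsp :=
  HB.pack (Lclass_quot f)
    (isFinLebesgue.Build _ _ _ _ _ p1 _ (Lclass_subproof f)).

Lemma LreprK (f : Lfn) : Lrepr (Lclass f) = f %[ae mu].
Proof. exact: repr_Lclass_quot. Qed.

Lemma Lnorm_Lclass (f : Lfn) :
  'N[mu]_p[EFin \o Lrepr (Lclass f)]%E = 'N[mu]_p[EFin \o f]%E.
Proof. exact: ae_eq_Lnorm (LreprK f). Qed.

Lemma Lspace_eqP (f g : Lsp) : f = g <-> Lrepr f = Lrepr g %[ae mu].
Proof.
split=> [->|fg]; first exact: ae_eq_refl.
have : (f : {mfun_ mu, T >-> mR}) = g.
  rewrite -[LHS]reprK -[RHS]reprK; apply/eqmodP; exact/asboolP.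
case: f g {fg} => [f [[f1]]] [g [[g1]]] /= fg; subst g.
by rewrite (Prop_irrelevance f1 g1).
Qed.

Definition Lspace_zero : Lsp := Lclass 0.
Definition Lspace_opp (f : Lsp) : Lsp := Lclass (- Lrepr f).
Definition Lspace_add (f g : Lsp) : Lsp := Lclass (Lrepr f + Lrepr g).
Definition Lspace_scale (a : R) (f : Lsp) : Lsp := Lclass (a *: Lrepr f).
Definition Lspace_norm (f : Lsp) : R := fine 'N[mu]_p[EFin \o Lrepr f]%E.

Lemma Lspace_ext (f g : Lsp) :
  (\forall x \ae mu, Lrepr f x = Lrepr g x) -> f = g.
Proof. by move=> fg; apply/Lspace_eqP; apply: filterS fg. Qed.

Lemma ae_S4 (P1 P2 P3 P4 Q : T -> Prop) :
  (forall x, P1 x -> P2 x -> P3 x -> P4 x -> Q x) ->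
  (\forall x \ae mu, P1 x) -> (\forall x \ae mu, P2 x) ->
  (\forall x \ae mu, P3 x) -> (\forall x \ae mu, P4 x) ->
  \forall x \ae mu, Q x.
Proof.
move=> PQ h1 h2 h3; apply: filterS2; last exact: filterI h1 (filterI h2 h3).
by move=> x [q1 [q2 q3]] q4; exact: PQ.
Qed.

Lemma LaddE f g : \forall x \ae mu,
  Lrepr (Lspace_add f g) x = Lrepr f x + Lrepr g x.
Proof. by have := LreprK (Lrepr f + Lrepr g); apply: filterS => x /(_ I). Qed.

Lemma LoppE f : \forall x \ae mu, Lrepr (Lspace_opp f) x = - Lrepr f x.
Proof. by have := LreprK (- Lrepr f); apply: filterS => x /(_ I). Qed.

Lemma LscaleE a f : \forall x \ae mu,
  Lrepr (Lspace_scale a f) x = a * Lrepr f x.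
Proof. by have := LreprK (a *: Lrepr f); apply: filterS => x /(_ I). Qed.

Lemma LzeroE : \forall x \ae mu, Lrepr Lspace_zero x = 0.
Proof. by have := LreprK 0; apply: filterS => x /(_ I). Qed.

Fact Lspace_addA : associative Lspace_add.
Proof.
move=> f g h; apply: Lspace_ext.
apply: (ae_S4 _ (LaddE f (Lspace_add g h)) (LaddE g h)
  (LaddE (Lspace_add f g) h) (LaddE f g)) => x e1 e2 e3 e4.
by rewrite e1 e2 e3 e4 addrA.
Qed.

Fact Lspace_addC : commutative Lspace_add.
Proof. by move=> f g; rewrite /Lspace_add addrC. Qed.

Fact Lspace_add0 : left_id Lspace_zero Lspace_add.
Proof.
move=> f; apply: Lspace_ext.
have := LaddE Lspace_zero f; have := LzeroE.
by apply: filterS2 => x e1 e2; rewrite e2 e1 add0r.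
Qed.

Fact Lspace_addN : left_inverse Lspace_zero Lspace_opp Lspace_add.
Proof.
move=> f; apply: Lspace_ext.
have := LaddE (Lspace_opp f) f; have := LzeroE; have := LoppE f.
by apply: filterS3 => x e1 e2 e3; rewrite e2 e3 e1 addNr.
Qed.

HB.instance Definition _ := GRing.isZmodule.Build Lsp
  Lspace_addA Lspace_addC Lspace_add0 Lspace_addN.

Fact Lspace_scaleA a b f :
  Lspace_scale a (Lspace_scale b f) = Lspace_scale (a * b) f.
Proof.
apply: Lspace_ext.
have := LscaleE a (Lspace_scale b f); have := LscaleE b f.
have := LscaleE (a * b) f.
by apply: filterS3 => x e1 e2 e3; rewrite e1 e3 e2 mulrA.
Qed.

Fact Lspace_scale1 : left_id 1 Lspace_scale.
Proof.
move=> f; apply: Lspace_ext.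
by have := LscaleE 1 f; apply: filterS => x ->; rewrite mul1r.
Qed.

Fact Lspace_scaleDr : right_distributive Lspace_scale Lspace_add.
Proof.
move=> a f g; apply: Lspace_ext.
have e : \forall x \ae mu,
    Lrepr (Lspace_scale a (Lspace_add f g)) x = a * (Lrepr f x + Lrepr g x).
  have := LscaleE a (Lspace_add f g); have := LaddE f g.
  by apply: filterS2 => x e1 e2; rewrite e2 e1.
apply: (ae_S4 _ e (LaddE (Lspace_scale a f) (Lspace_scale a g))
  (LscaleE a f) (LscaleE a g)) => x e1 e2 e3 e4.
by rewrite e1 e2 e3 e4 mulrDr.
Qed.

Fact Lspace_scaleDl f :
  {morph Lspace_scale^~ f : a b / a + b >-> Lspace_add a b}.
Proof.
move=> a b; apply: Lspace_ext.
apply: (ae_S4 _ (LscaleE (a + b) f)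
  (LaddE (Lspace_scale a f) (Lspace_scale b f))
  (LscaleE a f) (LscaleE b f)) => x e1 e2 e3 e4.
by rewrite e1 e2 e3 e4 mulrDl.
Qed.

HB.instance Definition _ := GRing.Zmodule_isLmodule.Build R Lsp
  Lspace_scaleA Lspace_scale1 Lspace_scaleDr Lspace_scaleDl.

Fact Lspace_ler_normD f g :
  Lspace_norm (f + g) <= Lspace_norm f + Lspace_norm g.
Proof.
rewrite {1}/Lspace_norm.
rewrite (Lnorm_Lclass (Lrepr f + Lrepr g)).
exact: ler_LnormD.
Qed.

Fact Lspace_normrZ (a : R) f : Lspace_norm (a *: f) = `|a| * Lspace_norm f.
Proof.
rewrite {1}/Lspace_norm.
rewrite (Lnorm_Lclass (a *: Lrepr f)).
by have -> := LnormZ (Lrepr f) a; rewrite -finite_norm_fine.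
Qed.

Fact Lspace_normr0_eq0 f : Lspace_norm f = 0 -> f = 0.
Proof.
move=> /fine_Lnormr_eq0 f0; apply: Lspace_ext.
by have := LzeroE; apply: filterS2 f0 => x /(_ I) -> ->.
Qed.

HB.instance Definition _ := Lmodule_isNormed.Build R Lsp
  Lspace_ler_normD Lspace_normrZ Lspace_normr0_eq0.

End Lspace_normedModType.

Lemma lt1_le1e (R : realType) (p : R) : 1 < p -> (1 <= p%:E)%E.
Proof. by move=> p1; rewrite lee_fin ltW. Qed.

Definition Lp d (T : measurableType d) (R : realType)
    (mu : {measure set T -> \bar R}) (p : R) (p1 : 1 < p) : normedModType R :=
  LspaceType mu (lt1_le1e p1).

Definition nearisometry (R : realType) (X Y : normedModType R) (eps : R)
    (f : X -> Y) : Prop :=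
  forall x y, `| `|f x - f y| - `|x - y| | <= eps.

(* Meant for bounded operators: the [sup] of an unbounded set is 0. *)
Definition opnorm (R : realType) (X Y : normedModType R) (T : X -> Y) : R :=
  sup [set `|T x| | x in [set x : X | `|x| <= 1]].

(* Main.v *)
(* The rescalings f(nx)/n have norm close to |x|, and so do their midpoints, so by
   uniform convexity of L^p they converge to some U x; U is an isometry fixing 0,
   hence linear because L^p is strictly convex.  Let J u = sgn(u) |u|^(p-1) be the
   duality map L^p -> L^q.  Comparing |f(nu) - f(x)| with |nu - x| to first order
   gives |<J(Uu), f(x)> - <Ju, x>| <= 2 eps |u|^(p-1).
   It remains to find T with <Ju, Ty> = <J(Uu), y> for all u: then T is linear,
   contractive, TU = id, and taking u = T f(x) - x gives the estimate.  By a Riesz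
   representation theorem Ty exists as soon as w |-> <J U J^-1 w, y> is linear on
   L^q.  For p = 2 the map J is linear.  For p <> 2 the equality case of Clarkson's
   inequality shows that U preserves disjointness of supports, so the functional is
   additive on disjoint functions, hence, being continuous and homogeneous, additive. *)

From HB Require Import structures.
Require Import Defs.
From mathcomp Require Import all_boot all_order all_algebra.
From mathcomp Require Import all_classical all_reals all_analysis.
From mathcomp Require Import ring lra measurable_realfun.

Set Implicit Arguments.
Unset Strict Implicit.
Unset Printing Implicit Defensive.

Import Order.TTheory GRing.Theory Num.Theory.
Import numFieldNormedType.Exports.
Local Open Scope classical_set_scope.
Local Open Scope ring_scope.

(** The obstacle is that [J] is nonlinear for p <> 2, so <Ju, Ty> = <J(Uu), y> is not an ordinary
    adjoint equation. It is nevertheless the right one: <Ju, .> is |u|^(p-1) times the derivative of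
    the norm at u, and this derivative is all that a comparison of the large numbers |f(nu) - f(x)|
    and |nu - x| can detect. The comparison costs eps twice, once for |f(nu)| and once for |f(nu) -
    f(x)|, whence the constant 2. Norm bounds then come back from the pairing through <Ju, u> =
    |u|^p. The analytic input is two scalar inequalities with a free tolerance t > 0, of the form
    error <= t size + K defect. They integrate directly, treat all exponents at once, and replace
    explicit moduli of continuity of [J] and of uniform convexity. *)

(** * Signed powers and scalar inequalities for |.|^p *)

Section Scalar.
Context {R : realType}.
Implicit Types (a b r p t x y s : R).

(** The sign factor gives [spow r 0 = 0] for every [r], negative ones included, so that [spow (-1)]
    is the inverse with 0^-1 = 0. *)
Definition spow r t : R := Num.sg t * `|t| `^ r.

Lemma conj_exponentE p q : p != 0 -> q != 0 -> p^-1 + q^-1 = 1 ->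
  (p - 1) * q = p.
Proof.
move=> p0 q0 pq; have : (p^-1 + q^-1) * (p * q) = q + p by field; rewrite p0 q0.
by rewrite pq => e; lra.
Qed.

Lemma spow0 r : spow r 0 = 0.
Proof. by rewrite /spow sgr0 mul0r. Qed.

Lemma spowM r a b : spow r (a * b) = spow r a * spow r b.
Proof. by rewrite /spow sgrM normrM powRM// mulrACA. Qed.

Lemma spowN r a : spow r (- a) = - spow r a.
Proof. by rewrite /spow sgrN normrN mulNr. Qed.

Lemma ge0_spow r a : 0 < r -> 0 <= a -> spow r a = a `^ r.
Proof.
move=> r0; rewrite le_eqVlt => /predU1P[<-|a0].
  by rewrite spow0 powR0// gt_eqF.
by rewrite /spow gtr0_sg// mul1r gtr0_norm.
Qed.

Lemma norm_spow r a : 0 < r -> `|spow r a| = `|a| `^ r.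
Proof.
move=> r0; have [->|a0] := eqVneq a 0.
  by rewrite spow0 normr0 powR0// gt_eqF.
by rewrite /spow normrM normr_sg a0 mul1r ger0_norm// powR_ge0.
Qed.

Lemma spow_mulr r a : 0 < r -> spow r a * a = `|a| `^ (r + 1).
Proof.
move=> r0; rewrite /spow mulrAC -normrEsg -(@mulr_powRB1 _ _ (r + 1)) ?addrK//.
by rewrite ltr_wpDl// ltW.
Qed.

Lemma spow1 a : spow 1 a = a.
Proof. by rewrite /spow powRr1// -numEsg. Qed.

Lemma onepowR r : 1 `^ r = 1 :> R.
Proof. by rewrite powR1. Qed.

Lemma spowK r s : 0 < r -> 0 < s -> r * s = 1 -> cancel (spow r) (spow s).
Proof.
move=> r0 s0 rs a; rewrite {1}/spow norm_spow// -powRrM rs powRr1//.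
have [->|a0] := eqVneq a 0; first by rewrite normr0 mulr0.
rewrite {1}/spow sgrM sgr_id [Num.sg (_ `^ _)]gtr0_sg ?mulr1 -?numEsg//.
by rewrite powR_gt0// normr_gt0.
Qed.

Lemma measurable_spow r : measurable_fun [set: R] (spow r).
Proof.
apply: measurable_funM.
  rewrite (_ : Num.sg =
      fun x : R => \1_(`]0, +oo[%classic) x - \1_(`]-oo, 0[%classic) x).
    apply: measurable_funB; exact: measurable_indic.
  apply/funext => x; rewrite !indicE !mem_setE !in_itv/= andbT.
  have [x0|x0|->] := ltrgt0P x.
  - by rewrite gtr0_sg// subr0.
  - by rewrite ltr0_sg// sub0r.
  - by rewrite sgr0 subrr.
apply: (@measurableT_comp _ _ _ _ _ _ (@powR R ^~ r)) => //.
Qed.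

(** After division by the number of larger modulus the other becomes some [u] with |u| <= 1. Near 1
    the difference of powers is below [t]; away from 1 it is at most 2 while |1 - u| is bounded
    below. The tolerance lets one argument cover r < 1 and r >= 1. *)
Lemma spow_sub_le r (t : R) : 0 < r -> 0 < t -> exists2 K : R, 0 <= K &
  forall a b, `|spow r a - spow r b| <=
    t * (`|a| `^ r + `|b| `^ r) + K * `|a - b| `^ r.
Proof.
move=> r0 t0; pose t' := Num.min t 2^-1.
have t'0 : 0 < t' by rewrite lt_min t0/= invr_gt0.
have t'1 : 0 < 1 - t'.
  by rewrite subr_gt0 gt_min; apply/orP; right; rewrite invf_lt1// ltr1n.
(* [s] solves (1 - s)^r = 1 - t' and [K] solves K s^r = 2; capping [t'] at 1/2 keeps 1 - t'
   positive. *)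
pose s := 1 - (1 - t') `^ r^-1.
have s1 : s < 1 by rewrite ltrBlDr ltrDl powR_gt0.
have s0 : 0 < s.
  rewrite subr_gt0 -[ltRHS](onepowR r^-1) gt0_ltr_powR ?invr_gt0 ?nnegrE//.
    exact: ltW.
  by rewrite ltrBlDr ltrDl.
have sE : (1 - s) `^ r = 1 - t'.
  by rewrite /s subKr -powRrM mulVf ?gt_eqF// powRr1// ltW.
pose K := 2 / s `^ r.
have K0 : 0 <= K by rewrite divr_ge0// powR_ge0.
exists K => //.
suff H a b : `|b| <= `|a| -> `|spow r a - spow r b| <=
    t * (`|a| `^ r + `|b| `^ r) + K * `|a - b| `^ r.
  move=> a b; have [/H//|/ltW ba] := leP `|b| `|a|.
  by rewrite distrC addrC [X in _ * X + _]addrC [`|a - b|]distrC addrC; exact: H.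
move=> ba; have [a0|a0] := eqVneq a 0.
  move: ba; rewrite a0 normr0 normr_le0 => /eqP ->.
  by rewrite !subrr !normr0 powR0 ?gt_eqF// addr0 !mulr0 addr0.
have [u bE] : exists u, b = a * u by exists (b / a); rewrite mulrCA mulfV// mulr1.
have u1 : `|u| <= 1 by move: ba; rewrite bE normrM ger_pMr ?normr_gt0.
have -> : spow r a - spow r b = spow r a * (1 - spow r u).
  by rewrite bE spowM mulrBr mulr1.
have -> : a - b = a * (1 - u) by rewrite bE mulrBr mulr1.
rewrite bE normrM norm_spow// !normrM !powRM// -[X in t * (X + _)]mulr1 -mulrDr.
rewrite mulrCA [K * _]mulrCA -mulrDr ler_wpM2l ?powR_ge0//.
have := u1; rewrite ler_norml => /andP[u1l u1r].
have [us|us] := leP (1 - s) u.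
  have u0 : 0 <= u by apply: le_trans us; rewrite subr_ge0 ltW.
  rewrite ge0_spow// ger0_norm ?subr_ge0.
    rewrite (@le_trans _ _ t)//.
      rewrite lerBlDr -lerBlDl (@le_trans _ _ (1 - t'))//.
        by rewrite lerB// ge_min lexx.
      rewrite -sE ge0_ler_powR ?nnegrE//; [exact: ltW|by rewrite subr_ge0 ltW].
    rewrite ler_wpDr ?(mulr_ge0 K0 (powR_ge0 _ _))//.
    by rewrite ler_peMr ?(ltW t0)// lerDl powR_ge0.
  by rewrite -[leRHS](onepowR r) ge0_ler_powR ?nnegrE// ltW.
rewrite (@le_trans _ _ 2)//.
  rewrite (le_trans (ler_normB _ _))// normr1 lerD2l norm_spow//.
  by rewrite -[leRHS](onepowR r) ge0_ler_powR ?nnegrE// ltW.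
rewrite ler_wpDl ?mulr_ge0 ?addr_ge0 ?powR_ge0 ?(ltW t0)//.
rewrite /K -mulrA ler_peMr// mulrC ler_pdivlMr ?powR_gt0// mul1r.
rewrite ge0_ler_powR ?nnegrE//; [exact: ltW|exact: ltW|].
by rewrite ger0_norm ?subr_ge0// lerBrDr -lerBrDl ltW.
Qed.

(** Gap at [x] between |.|^p and its tangent at [y]; the derivative of |.|^p is p times
    [spow (p - 1)]. *)
Definition bregman p x y := `|x| `^ p - `|y| `^ p - p * spow (p - 1) y * (x - y).

Lemma bregmanE p x y : 1 < p ->
  bregman p x y = `|x| `^ p + (p - 1) * `|y| `^ p - p * (spow (p - 1) y * x).
Proof.
move=> p1; have := @spow_mulr (p - 1) y; rewrite subr_gt0 subrK => /(_ p1) e.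
by rewrite /bregman mulrBr -(mulrA p _ y) e; ring.
Qed.

(** Young's inequality for |x| and |y|^(p-1), with exponents p and p / (p - 1). *)
Lemma bregman_ge0 p x y : 1 < p -> 0 <= bregman p x y.
Proof.
move=> p1; have p0 : 0 < p by lra.
rewrite bregmanE// subr_ge0.
have p10 : 0 < p - 1 by lra.
have := @conjugate_powR R `|x| (`|y| `^ (p - 1)) p (p / (p - 1)) (normr_ge0 _)
  (powR_ge0 _ _) p0 (divr_gt0 p0 p10).
rewrite invf_div -{1}(div1r p) -mulrDl subrKC mulfV ?gt_eqF// => /(_ erefl).
rewrite -powRrM [(p - 1) * _]mulrC divfK ?gt_eqF// => H.
rewrite (@le_trans _ _ (p * (`|y| `^ (p - 1) * `|x|)))//.
  rewrite ler_pM2l// (le_trans (ler_norm _))// normrM norm_spow//.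
move: H; rewrite mulrC -(ler_pM2l p0) => /le_trans; apply.
rewrite mulrDr [p * (_ / p)]mulrC divfK ?gt_eqF// lerD2l.
rewrite mulrCA [p * (_ / p)]mulrC divfK ?gt_eqF//.
by rewrite mulrC.
Qed.

(** For m = e^y the gap is m^(p-1) (e^(-(p-1)y) + (p-1) e^y - p), and the strict inequality 1 + z <
    e^z at z = y and z = -(p-1)y makes the bracket positive. *)
Lemma bregman_gt0 p m : 1 < p -> 0 <= m < 1 -> 0 < bregman p 1 m.
Proof.
move=> p1 /andP[]; rewrite le_eqVlt => /predU1P[<- _|m0 m1].
  rewrite /bregman spow0 normr1 normr0 onepowR powR0; last by lra.
  by rewrite mulr0 mul0r !subr0.
have p10 : 0 < p - 1 by rewrite subr_gt0.
rewrite bregmanE// ge0_spow ?ltW// normr1 onepowR gtr0_norm// mulr1.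
pose y := ln m.
have mE : m = expR y by rewrite lnK.
have y0 : y != 0 by rewrite lt_eqF// -expR_lt1 -mE.
rewrite mE -!expRM; set E := expR (y * (p - 1)).
have -> : expR (y * p) = E * expR y by rewrite -expRD mulrBr mulr1 subrK.
have e1 : 1 = E * expR (- (y * (p - 1))) by rewrite expRxMexpNx_1.
rewrite {1}e1 mulrCA [p * _]mulrC -mulrDr -mulrBr mulr_gt0 ?expR_gt0//.
have h1 := expR_gt1Dx y0.
have h2 : 1 - y * (p - 1) < expR (- (y * (p - 1))).
  by apply: expR_gt1Dx; rewrite oppr_eq0 mulf_neq0// gt_eqF.
have h3 : (p - 1) * (1 + y) < (p - 1) * expR y by rewrite ltr_pM2l.
lra.
Qed.

(* The three-point identity
   [bregman x z = bregman x y + bregman y z + p (psi y - psi z) (x - y)]. *)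
Lemma bregman1_decr p m y : 1 < p -> 0 <= m -> m <= y -> y <= 1 ->
  bregman p 1 y <= bregman p 1 m.
Proof.
move=> p1 m0 my y1; have p10 : 0 < p - 1 by rewrite subr_gt0.
have y0 := le_trans m0 my.
have -> : bregman p 1 m = bregman p 1 y + bregman p y m +
    p * (spow (p - 1) y - spow (p - 1) m) * (1 - y).
  by rewrite /bregman; ring.
rewrite -addrA lerDl addr_ge0 ?bregman_ge0// mulr_ge0 ?subr_ge0//.
rewrite mulr_ge0 ?subr_ge0//; first by lra.
by rewrite !ge0_spow// ge0_ler_powR ?nnegrE// ltW.
Qed.

Definition cvx_defect p a b := (`|a| `^ p + `|b| `^ p) / 2 - `|(a + b) / 2| `^ p.

(** The tangent terms at the midpoint cancel because [a] and [b] are symmetric about it. *)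
Lemma cvx_defectE p a b :
  cvx_defect p a b = (bregman p a ((a + b) / 2) + bregman p b ((a + b) / 2)) / 2.
Proof. by rewrite /cvx_defect /bregman; field. Qed.

Lemma cvx_defect_ge0 p a b : 1 < p -> 0 <= cvx_defect p a b.
Proof. by move=> p1; rewrite cvx_defectE divr_ge0// addr_ge0// bregman_ge0. Qed.

Lemma cvx_defectC p a b : cvx_defect p a b = cvx_defect p b a.
Proof. by rewrite /cvx_defect [`|a| `^ p + _]addrC [a + b]addrC. Qed.

Lemma cvx_defectZ p c a b : cvx_defect p (c * a) (c * b) = `|c| `^ p * cvx_defect p a b.
Proof. by rewrite /cvx_defect -mulrDr -mulrA !normrM !powRM//; ring. Qed.

(* By homogeneity [|b| <= |a| = 1]: either [b] is close to [a], or the defect is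
   at least a positive constant. *)
Lemma cvx_defect_le p (t : R) : 1 < p -> 0 < t -> exists2 K : R, 0 <= K &
  forall a b, `|a - b| `^ p <=
    t * (`|a| `^ p + `|b| `^ p) + K * cvx_defect p a b.
Proof.
move=> p1 t0; have p0 : 0 < p by lra.
(* s^p <= t settles the case u >= 1 - s. Otherwise the midpoint of 1 and [u] lies below [m1], so the
   defect is at least [c], and K c = 2^p dominates |1 - u|^p. *)
pose s := Num.min 1 (t `^ p^-1).
have s0 : 0 < s by rewrite lt_min ltr01/= powR_gt0.
have s1 : s <= 1 by rewrite ge_min lexx.
have st : s `^ p <= t.
  have -> : t = (t `^ p^-1) `^ p.
    by rewrite -powRrM mulVf ?gt_eqF// powRr1// ltW.
  by rewrite ge0_ler_powR ?nnegrE ?powR_ge0 ?(ltW p0) ?(ltW s0)// /s ge_min lexx orbT.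
pose m1 := 1 - s / 2.
have m1P : 0 <= m1 < 1 by rewrite /m1; lra.
pose c := bregman p 1 m1 / 2.
have c0 : 0 < c by rewrite divr_gt0// bregman_gt0.
pose K := 2 `^ p / c.
have K0 : 0 <= K by rewrite divr_ge0 ?powR_ge0// ltW.
exists K => //.
suff H a b : `|b| <= `|a| -> `|a - b| `^ p <=
    t * (`|a| `^ p + `|b| `^ p) + K * cvx_defect p a b.
  move=> a b; have [/H//|/ltW ba] := leP `|b| `|a|.
  by rewrite distrC addrC [X in _ * X]addrC cvx_defectC addrC; exact: H.
move=> ba; have [a0|a0] := eqVneq a 0.
  move: ba; rewrite a0 normr0 normr_le0 => /eqP ->.
  rewrite subrr normr0 powR0 ?gt_eqF// addr0 mulr0 add0r.
  by rewrite mulr_ge0 ?cvx_defect_ge0.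
have [u bE] : exists u, b = a * u by exists (b / a); rewrite mulrCA mulfV// mulr1.
have u1 : `|u| <= 1 by move: ba; rewrite bE normrM ger_pMr ?normr_gt0.
have -> : cvx_defect p a b = `|a| `^ p * cvx_defect p 1 u.
  by rewrite -cvx_defectZ mulr1 -bE.
have -> : a - b = a * (1 - u) by rewrite bE mulrBr mulr1.
rewrite bE !normrM !powRM// -[X in X + _ * _ `^ _](mulr1 (_ `^ p)) -mulrDr.
rewrite mulrCA [K * _]mulrCA -mulrDr ler_wpM2l ?powR_ge0//.
have := u1; rewrite ler_norml => /andP[u1l u1r].
rewrite ger0_norm ?subr_ge0//.
have [us|us] := leP (1 - s) u.
  rewrite (@le_trans _ _ t)//.
    apply: le_trans st; rewrite ge0_ler_powR ?nnegrE ?subr_ge0 ?(ltW p0) ?(ltW s0)//.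
    by rewrite lerBlDr -lerBlDl.
  rewrite ler_wpDr ?(mulr_ge0 K0 (cvx_defect_ge0 _ _ p1))//.
  by rewrite ler_peMr ?(ltW t0)// lerDl powR_ge0.
rewrite ler_wpDl ?mulr_ge0 ?addr_ge0 ?powR_ge0 ?(ltW t0)//.
rewrite (@le_trans _ _ (2 `^ p))//.
  rewrite ge0_ler_powR ?nnegrE ?subr_ge0 ?(ltW p0)//; lra.
rewrite /K -mulrA ler_peMr ?powR_ge0// mulrC ler_pdivlMr// mul1r.
rewrite cvx_defectE /c ler_pM2r// ler_wpDr ?bregman_ge0//.
by apply: bregman1_decr; rewrite // /m1; lra.
Qed.

(** Normalised by x + y, this is z^r < z on (0, 1), added over two values of z with sum 1. *)
Lemma powR_superadd r x y : 1 < r -> 0 < x -> 0 < y -> x `^ r + y `^ r < (x + y) `^ r.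
Proof.
move=> r1 x0 y0; have xy0 : 0 < x + y by rewrite addr_gt0.
suff H z : 0 < z -> z < 1 -> z `^ r < z.
  have e z : 0 < z -> z `^ r = (z / (x + y)) `^ r * (x + y) `^ r.
    by move=> z0; rewrite -powRM ?divfK ?divr_ge0 ?(ltW z0) ?(ltW xy0)// gt_eqF.
  rewrite (e x)// (e y)// -mulrDl gtr_pMl ?powR_gt0//.
  have -> : 1 = x / (x + y) + y / (x + y) by rewrite -mulrDl divff ?gt_eqF.
  by rewrite ltrD// H ?divr_gt0// ltr_pdivrMr// mul1r ?ltrDl ?ltrDr.
move=> z0 z1; rewrite -mulr_powRB1 ?(ltW z0)//; last by lra.
rewrite gtr_pMr// -[ltRHS](onepowR (r - 1)) gt0_ltr_powR ?nnegrE ?(ltW z0)//.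
by rewrite subr_gt0.
Qed.

Lemma midpoint_powR r x y : 1 < r -> 0 <= x -> 0 <= y ->
  ((x + y) / 2) `^ r <= (x `^ r + y `^ r) / 2.
Proof.
move=> r1 x0 y0; have := @cvx_defect_ge0 r x y r1.
by rewrite /cvx_defect subr_ge0 !ger0_norm// divr_ge0// addr_ge0.
Qed.

(** Deviation from the parallelogram law, identically 0 for p = 2. *)
Definition clarkson p a b :=
  `|a + b| `^ p + `|a - b| `^ p - 2 * (`|a| `^ p + `|b| `^ p).

Let norm_sqr_powR p a : `|a| `^ p = (a ^+ 2) `^ (p / 2).
Proof.
rewrite -real_normK ?num_real// -powR_mulrn// -powRrM mulrC divfK//.
Qed.

(** Convexity of the power p/2 is applied to (a + b)^2 and (a - b)^2, whose mean is a^2 + b^2, then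
    superadditivity to a^2 and b^2. The latter is strict when both are nonzero, which is the
    equality case. *)
Lemma clarkson_gt2 p a b : 2 < p ->
  0 <= clarkson p a b /\ (clarkson p a b = 0 -> a * b = 0).
Proof.
move=> p2; have r1 : 1 < p / 2 by rewrite ltr_pdivlMr// mul1r.
have r0 : 0 < p / 2 by lra.
have h1 : 2 * (a ^+ 2 + b ^+ 2) `^ (p / 2) <= `|a + b| `^ p + `|a - b| `^ p.
  rewrite !norm_sqr_powR.
  have := midpoint_powR r1 (sqr_ge0 (a + b)) (sqr_ge0 (a - b)).
  rewrite (_ : (_ + _) / 2 = a ^+ 2 + b ^+ 2); last by field.
  by rewrite ler_pdivlMr// mulrC.
have [->|a0] := eqVneq a 0.
  rewrite /clarkson mul0r sub0r add0r normrN normr0 powR0 ?gt_eqF//; last by lra.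
  by split=> //; lra.
have [->|b0] := eqVneq b 0.
  rewrite /clarkson mulr0 subr0 addr0 normr0 powR0 ?gt_eqF//; last by lra.
  by split=> //; lra.
rewrite /clarkson !(norm_sqr_powR p a) !(norm_sqr_powR p b).
have := @powR_superadd (p / 2) (a ^+ 2) (b ^+ 2) r1.
rewrite !exprn_even_gt0//= => /(_ a0 b0) h2.
by split; [|move=> h]; lra.
Qed.

(** The power p/2 is now concave; both steps come from applying the convex power 2/p to the p/2-th
    powers and inverting. *)
Lemma clarkson_lt2 p a b : 1 < p -> p < 2 ->
  clarkson p a b <= 0 /\ (clarkson p a b = 0 -> a * b = 0).
Proof.
move=> p1 p2; have r1 : 1 < (p / 2)^-1.
  by rewrite invf_gt1 ?ltr_pdivrMr ?mul1r// divr_gt0//; lra.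
have r0 : 0 < p / 2 by lra.
have pK z : 0 <= z -> (z `^ (p / 2)) `^ (p / 2)^-1 = z.
  by move=> z0; rewrite -powRrM mulfV ?gt_eqF// powRr1.
have Kp z : 0 <= z -> (z `^ (p / 2)^-1) `^ (p / 2) = z.
  by move=> z0; rewrite -powRrM mulVf ?gt_eqF// powRr1.
have h1 : `|a + b| `^ p + `|a - b| `^ p <= 2 * (a ^+ 2 + b ^+ 2) `^ (p / 2).
  rewrite !norm_sqr_powR.
  have := midpoint_powR r1 (powR_ge0 ((a + b) ^+ 2) (p / 2))
    (powR_ge0 ((a - b) ^+ 2) (p / 2)).
  rewrite !pK ?sqr_ge0// (_ : (_ ^+ 2 + _) / 2 = a ^+ 2 + b ^+ 2); last by field.
  move=> /(@ge0_ler_powR _ (p / 2) (ltW r0)).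
  rewrite !nnegrE powR_ge0 addr_ge0 ?sqr_ge0// => /(_ isT isT) /=.
  rewrite Kp; last by rewrite divr_ge0// addr_ge0 ?powR_ge0.
  by rewrite ler_pdivrMr// [_ * 2]mulrC.
have [->|a0] := eqVneq a 0.
  rewrite /clarkson mul0r sub0r add0r normrN normr0 powR0 ?gt_eqF//; last by lra.
  by split=> //; lra.
have [->|b0] := eqVneq b 0.
  rewrite /clarkson mulr0 subr0 addr0 normr0 powR0 ?gt_eqF//; last by lra.
  by split=> //; lra.
rewrite /clarkson !(norm_sqr_powR p a) !(norm_sqr_powR p b).
have a20 : 0 < a ^+ 2 by rewrite exprn_even_gt0.
have b20 : 0 < b ^+ 2 by rewrite exprn_even_gt0.
have h2 : (a ^+ 2 + b ^+ 2) `^ (p / 2) < (a ^+ 2) `^ (p / 2) + (b ^+ 2) `^ (p / 2).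
  have := @powR_superadd (p / 2)^-1 ((a ^+ 2) `^ (p / 2)) ((b ^+ 2) `^ (p / 2)) r1.
  rewrite !powR_gt0// => /(_ isT isT); rewrite !pK ?sqr_ge0//.
  move=> /(@gt0_ltr_powR _ (p / 2) r0).
  rewrite !nnegrE powR_ge0 addr_ge0 ?sqr_ge0// => /(_ isT isT) /=.
  by rewrite Kp ?addr_ge0 ?powR_ge0.
by split; [|move=> h]; lra.
Qed.

End Scalar.

(** * L^p through representatives and almost everywhere identities *)

HB.lock Definition rep d (T : measurableType d) (R : realType)
    (mu : {measure set T -> \bar R}) (p : R) (p1 : 1 < p) (u : Lp mu p1) : T -> R :=
  @Lrepr _ _ _ mu p%:E (lt1_le1e p1) u.

(* Junk value [0] when [f] is not measurable or not p-integrable. *)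
HB.lock Definition toLp d (T : measurableType d) (R : realType)
    (mu : {measure set T -> \bar R}) (p : R) (p1 : 1 < p) (f : T -> R) : Lp mu p1 :=
  xget 0 [set u | \forall x \ae mu, rep u x = f x].
Arguments toLp {d T R} mu {p} p1 f.

Section LpSpace.
Context d (T : measurableType d) (R : realType) (mu : {measure set T -> \bar R}).

Lemma ae_and (P Q : T -> Prop) :
  (\forall x \ae mu, P x) -> (\forall x \ae mu, Q x) ->
  \forall x \ae mu, P x /\ Q x.
Proof. exact: filterI. Qed.

Lemma ae_eq_Rintegral (f g : T -> R) :
  measurable_fun setT f -> measurable_fun setT g ->
  (\forall x \ae mu, f x = g x) -> \int[mu]_x f x = \int[mu]_x g x.
Proof.
move=> mf mg fg; congr fine; apply: ae_eq_integral => //.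
- exact/measurable_EFinP.
- exact/measurable_EFinP.
- by apply: filterS fg => x -> _.
Qed.

Lemma ae_eq_integrable (f g : T -> R) :
  measurable_fun setT f -> measurable_fun setT g ->
  (\forall x \ae mu, f x = g x) -> mu.-integrable setT (EFin \o f) ->
  mu.-integrable setT (EFin \o g).
Proof.
move=> mf mg fg /integrableP[_ fi]; apply/integrableP; split.
  exact/measurable_EFinP.
suff <- : (\int[mu]_x `|(EFin \o f) x| = \int[mu]_x `|(EFin \o g) x|)%E by [].
apply: ae_eq_integral => //.
- by apply/measurable_EFinP; exact: measurableT_comp.
- by apply/measurable_EFinP; exact: measurableT_comp.
- by apply: filterS fg => x /= -> _.
Qed.

(** [le_Rintegral] wants the inequality everywhere, so [g] is replaced by max(f, g), which equals it
    almost everywhere. *)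
Lemma ae_le_Rintegral (f g : T -> R) :
  mu.-integrable setT (EFin \o f) -> mu.-integrable setT (EFin \o g) ->
  (\forall x \ae mu, f x <= g x) -> \int[mu]_x f x <= \int[mu]_x g x.
Proof.
move=> fi gi fg.
have mf : measurable_fun setT f by have /integrableP[/measurable_EFinP] := fi.
have mg : measurable_fun setT g by have /integrableP[/measurable_EFinP] := gi.
pose h x := Num.max (f x) (g x).
have mh : measurable_fun setT h by exact: measurable_maxr.
have hg : \forall x \ae mu, g x = h x.
  by apply: filterS fg => x fgx; rewrite /h (max_idPr fgx).
rewrite (ae_eq_Rintegral mg mh hg).
apply: le_Rintegral => //; first exact: (ae_eq_integrable mg mh hg).
by move=> x _; rewrite /h le_max lexx.
Qed.

Section one_exponent.
Context (p : R) (p1 : 1 < p).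
Notation X := (Lp mu p1).
Implicit Types u v w : X.

Let p0 : 0 < p. Proof. exact: lt_trans p1. Qed.
Let pn0 : p != 0. Proof. by rewrite gt_eqF. Qed.

Lemma measurable_rep u : measurable_fun setT (rep u).
Proof. rewrite rep.unlock; exact: measurable_funPT. Qed.

Definition inLp (f : T -> R) := measurable_fun setT f /\
  mu.-integrable setT (EFin \o (fun x => `|f x| `^ p)).

Lemma measurable_normr_powR (f : T -> R) r : measurable_fun setT f ->
  measurable_fun setT (fun x => `|f x| `^ r).
Proof.
move=> mf; apply: (@measurableT_comp _ _ _ _ _ _ (@powR R ^~ r)) => //.
exact: measurableT_comp.
Qed.

Lemma inLp_Lfun f : inLp f <-> f \in Lfun mu p%:E.
Proof.
split.
  move=> [mf /integrableP[_ fi]]; apply/andP; rewrite !inE; split=> //=.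
  rewrite /finite_norm unlock /=; apply: poweR_lty.
  apply: le_lt_trans fi; rewrite le_eqVlt; apply/orP; left; apply/eqP.
  by apply: eq_integral => x _; rewrite /= [in RHS]ger0_norm// powR_ge0.
move=> fL; split; last exact: Lfun_integrable (ltW p1) fL.
by move: fL => /andP[]; rewrite inE.
Qed.

Lemma inLp_rep u : inLp (rep u).
Proof. by apply/inLp_Lfun; rewrite rep.unlock; exact: Lrepr_subproof. Qed.

Lemma rep_integrable u : mu.-integrable setT (EFin \o (fun x => `|rep u x| `^ p)).
Proof. by have [] := inLp_rep u. Qed.

Lemma rep_ext (u v : X) : (\forall x \ae mu, rep u x = rep v x) -> u = v.
Proof. rewrite rep.unlock; exact: Lspace_ext. Qed.

Lemma repD (u v : X) : \forall x \ae mu, rep (u + v) x = rep u x + rep v x.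
Proof. rewrite rep.unlock; exact: LaddE. Qed.

Lemma repN (u : X) : \forall x \ae mu, rep (- u) x = - rep u x.
Proof. rewrite rep.unlock; exact: LoppE. Qed.

Lemma repB (u v : X) : \forall x \ae mu, rep (u - v) x = rep u x - rep v x.
Proof. by apply: (filterS2 _ _ (repD u (- v)) (repN v)) => x -> ->. Qed.

Lemma repZ a (u : X) : \forall x \ae mu, rep (a *: u) x = a * rep u x.
Proof. rewrite rep.unlock; exact: LscaleE. Qed.

Lemma rep0 : \forall x \ae mu, rep (0 : X) x = 0.
Proof. rewrite rep.unlock; exact: LzeroE. Qed.

Lemma Lp_normE (u : X) : `|u| `^ p = \int[mu]_x `|rep u x| `^ p.
Proof.
rewrite rep.unlock.
change (`|u| `^ p) with
  ((fine ('N[mu]_p%:E[EFin \o @Lrepr _ _ _ mu p%:E (lt1_le1e p1) u]%E)) `^ p).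
by rewrite -fine_poweR poweR_Lnorm.
Qed.

Lemma Lnorm_rep (u : X) : 'N[mu]_p%:E[EFin \o rep u]%E = (`|u|)%:E.
Proof. by rewrite rep.unlock -[LHS](finite_norm_fine (Lrepr u)). Qed.

Lemma toLpE f : inLp f -> \forall x \ae mu, rep (toLp mu p1 f) x = f x.
Proof.
move=> /inLp_Lfun fL; rewrite toLp.unlock; case: xgetP => [u _//|].
move=> /(_ (Lclass (@Lfun_Sub _ _ _ mu p%:E (lt1_le1e p1) f fL)))/= [].
rewrite rep.unlock.
have := LreprK (@Lfun_Sub _ _ _ mu p%:E (lt1_le1e p1) f fL).
by apply: filterS => x /(_ I).
Qed.

Lemma inLp_le (f g : T -> R) : measurable_fun setT f -> inLp g ->
  (forall x, `|f x| <= `|g x|) -> inLp f.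
Proof.
move=> mf [mg gi] fg; split=> //; apply: le_integrable gi => //.
  exact/measurable_EFinP/measurable_normr_powR.
move=> x _ /=; rewrite lee_fin [leLHS]ger0_norm ?powR_ge0// [leRHS]ger0_norm ?powR_ge0//.
by rewrite ge0_ler_powR ?nnegrE// ltW.
Qed.

Lemma Lp_norm_le (u v : X) : (\forall x \ae mu, `|rep u x| <= `|rep v x|) -> `|u| <= `|v|.
Proof.
move=> uv; rewrite leNgt; apply/negP => /(@gt0_ltr_powR _ p p0).
rewrite !nnegrE => /(_ (normr_ge0 _) (normr_ge0 _)); apply/negP; rewrite -leNgt !Lp_normE.
apply: ae_le_Rintegral; [exact: rep_integrable|exact: rep_integrable|].
by apply: filterS uv => x uv; rewrite ge0_ler_powR ?nnegrE// ltW.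
Qed.

Definition absLp (u : X) : X := toLp mu p1 (fun x => `|rep u x|).

Lemma absLpE u : \forall x \ae mu, rep (absLp u) x = `|rep u x|.
Proof.
apply: toLpE; apply: (inLp_le _ (inLp_rep u)) => [|x]; last by rewrite normr_id.
exact: measurableT_comp (measurable_rep u).
Qed.

Lemma norm_absLp u : `|absLp u| = `|u|.
Proof.
by apply/eqP; rewrite eq_le; apply/andP; split; apply: Lp_norm_le;
  apply: filterS (absLpE u) => x ->; rewrite normr_id.
Qed.

(** Minkowski's inequality for the absolute values; it turns pointwise scalar bounds into norm
    bounds. *)
Lemma Lp_norm_le3 (a b c : R) (z u v w : X) : 0 <= a -> 0 <= b -> 0 <= c ->
  (\forall x \ae mu, `|rep z x| <= a * `|rep u x| + b * `|rep v x| + c * `|rep w x|) ->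
  `|z| <= a * `|u| + b * `|v| + c * `|w|.
Proof.
move=> a0 b0 c0 H.
pose s := a *: absLp u + b *: absLp v + c *: absLp w.
apply: (@le_trans _ _ `|s|).
  apply: Lp_norm_le.
  have e1 := repD (a *: absLp u + b *: absLp v) (c *: absLp w).
  have e2 := repD (a *: absLp u) (b *: absLp v).
  have e3 := ae_and (repZ a (absLp u)) (absLpE u).
  have e4 := ae_and (repZ b (absLp v)) (absLpE v).
  have e5 := ae_and (repZ c (absLp w)) (absLpE w).
  have e6 := ae_and (ae_and H e1) (ae_and e2 (ae_and e3 (ae_and e4 e5))).
  apply: filterS e6 => x [[h g1] [g2 [[g3 g3'] [[g4 g4'] [g5 g5']]]]].
  rewrite g1 g2 g3 g4 g5 g3' g4' g5'; apply: le_trans h _; exact: ler_norm.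
rewrite (le_trans (ler_normD _ _))// lerD//; last by rewrite normrZ ger0_norm// norm_absLp.
rewrite (le_trans (ler_normD _ _))// lerD//; rewrite normrZ ger0_norm// norm_absLp//.
Qed.

End one_exponent.
End LpSpace.

(** * Duality map and pairing *)

(** [p] and [q] enter as independent exponents, so that exchanging them gives the inverse map; see
    [dmapK]. *)
HB.lock Definition dmap d (T : measurableType d) (R : realType)
    (mu : {measure set T -> \bar R}) (p : R) (p1 : 1 < p) (q : R) (q1 : 1 < q)
    (u : Lp mu p1) : Lp mu q1 :=
  toLp mu q1 (fun x => spow (p - 1) (rep u x)).
Arguments dmap {d T R mu p p1 q} q1 u.

HB.lock Definition pairing d (T : measurableType d) (R : realType)
    (mu : {measure set T -> \bar R}) (p : R) (p1 : 1 < p) (q : R) (q1 : 1 < q)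
    (w : Lp mu q1) (u : Lp mu p1) : R := \int[mu]_x (rep w x * rep u x).

Section Duality.
Context d (T : measurableType d) (R : realType) (mu : {measure set T -> \bar R}).

Section pairing.
Context (p : R) (p1 : 1 < p) (q : R) (q1 : 1 < q) (pq : p^-1 + q^-1 = 1).
Implicit Types (u v : Lp mu p1) (w : Lp mu q1).

Let p0 : 0 < p. Proof. exact: lt_trans p1. Qed.
Let q0 : 0 < q. Proof. exact: lt_trans q1. Qed.
Let p10 : 0 < p - 1. Proof. by rewrite subr_gt0. Qed.

Let qp1 : (p - 1) * q = p.
Proof. by apply: conj_exponentE => //; rewrite gt_eqF. Qed.

Let measurable_prod w u : measurable_fun setT (fun x => rep w x * rep u x).
Proof. by apply: measurable_funM; exact: measurable_rep. Qed.

Let hoelder_rep w u :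
  (\int[mu]_x (`|rep w x * rep u x|)%:E <= (`|w| * `|u|)%:E)%E.
Proof.
have := @hoelder _ _ _ mu (rep w) (rep u) q p (measurable_rep w) (measurable_rep u) q0 p0.
rewrite addrC => /(_ pq); rewrite Lnorm1 /= => H; apply: le_trans H _.
by rewrite !Lnorm_rep -EFinM.
Qed.

Lemma pairing_integrable w u :
  mu.-integrable setT (EFin \o (fun x => rep w x * rep u x)).
Proof.
apply/integrableP; split; first exact/measurable_EFinP.
exact: le_lt_trans (hoelder_rep w u) (ltry _).
Qed.

Lemma pairing_le w u : `|pairing w u| <= `|w| * `|u|.
Proof.
rewrite pairing.unlock.
apply: le_trans (le_normr_Rintegral measurableT (pairing_integrable w u)) _.
rewrite -lee_fin fineK; first exact: hoelder_rep.
rewrite ge0_fin_numE; first exact: le_lt_trans (hoelder_rep w u) (ltry _).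
by apply: integral_ge0 => x _; rewrite lee_fin.
Qed.

Lemma pairingDr w u v : pairing w (u + v) = pairing w u + pairing w v.
Proof.
rewrite pairing.unlock -RintegralD//; [|exact: pairing_integrable..].
apply: ae_eq_Rintegral => //; first exact: measurable_funD.
by apply: filterS (repD u v) => x ->; rewrite mulrDr.
Qed.

Lemma pairingZr w a u : pairing w (a *: u) = a * pairing w u.
Proof.
rewrite pairing.unlock -RintegralZl//; last exact: pairing_integrable.
apply: ae_eq_Rintegral => //; first exact: measurable_funM.
by apply: filterS (repZ a u) => x ->; rewrite mulrCA.
Qed.

Lemma pairingNr w u : pairing w (- u) = - pairing w u.
Proof. by rewrite -scaleN1r pairingZr mulN1r. Qed.

Lemma pairingBr w u v : pairing w (u - v) = pairing w u - pairing w v.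
Proof. by rewrite pairingDr pairingNr. Qed.

Lemma pairingDl w w' u : pairing (w + w') u = pairing w u + pairing w' u.
Proof.
rewrite pairing.unlock -RintegralD//; [|exact: pairing_integrable..].
apply: ae_eq_Rintegral => //; first exact: measurable_funD.
by apply: filterS (repD w w') => x ->; rewrite mulrDl.
Qed.

Lemma pairingZl a w u : pairing (a *: w) u = a * pairing w u.
Proof.
rewrite pairing.unlock -RintegralZl//; last exact: pairing_integrable.
apply: ae_eq_Rintegral => //; first exact: measurable_funM.
by apply: filterS (repZ a w) => x ->; rewrite mulrA.
Qed.

Lemma pairingNl w u : pairing (- w) u = - pairing w u.
Proof. by rewrite -scaleN1r pairingZl mulN1r. Qed.

Lemma pairingBl w w' u : pairing (w - w') u = pairing w u - pairing w' u.
Proof. by rewrite pairingDl pairingNl. Qed.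

Local Notation dmap := (dmap q1).

Lemma measurable_spow_rep u r : measurable_fun setT (fun x => spow r (rep u x)).
Proof. exact: measurableT_comp (measurable_spow r) (measurable_rep u). Qed.

Let norm_spow_rep u x : `|spow (p - 1) (rep u x)| `^ q = `|rep u x| `^ p.
Proof. by rewrite norm_spow// -powRrM qp1. Qed.

Lemma dmapE u : \forall x \ae mu, rep (dmap u) x = spow (p - 1) (rep u x).
Proof.
rewrite dmap.unlock; apply: toLpE; split; first exact: measurable_spow_rep.
by under eq_fun do rewrite norm_spow_rep; exact: rep_integrable.
Qed.

Lemma norm_dmap u : `|dmap u| = `|u| `^ (p - 1).
Proof.
apply: (@powR_injective _ q q0); rewrite ?nnegrE ?powR_ge0//.
rewrite -powRrM qp1 !Lp_normE; apply: ae_eq_Rintegral.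
- exact/measurable_normr_powR/measurable_rep.
- exact/measurable_normr_powR/measurable_rep.
- by apply: filterS (dmapE u) => x ->.
Qed.

Lemma pairing_dmap u : pairing (dmap u) u = `|u| `^ p.
Proof.
rewrite Lp_normE pairing.unlock; apply: ae_eq_Rintegral => //.
  exact/measurable_normr_powR/measurable_rep.
by apply: filterS (dmapE u) => x ->; rewrite spow_mulr// subrK.
Qed.

Lemma dmapZ a u : dmap (a *: u) = spow (p - 1) a *: dmap u.
Proof.
apply: rep_ext; have e1 := ae_and (dmapE (a *: u)) (repZ a u).
have e2 := ae_and (repZ (spow (p - 1) a) (dmap u)) (dmapE u).
by apply: filterS (ae_and e1 e2) => x [[-> ->] [-> ->]]; rewrite spowM.
Qed.

Lemma dmapD2 u v : p = 2 -> dmap (u + v) = dmap u + dmap v.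
Proof.
move=> p2; have e : p - 1 = 1 by lra.
have E (w : Lp mu p1) : \forall x \ae mu, rep (dmap w) x = rep w x.
  by apply: filterS (dmapE w) => x ->; rewrite e spow1.
apply: rep_ext; have e1 := ae_and (E (u + v)) (repD u v).
have e2 := ae_and (repD (dmap u) (dmap v)) (ae_and (E u) (E v)).
by apply: filterS (ae_and e1 e2) => x [[-> ->] [-> [-> ->]]].
Qed.

Lemma dmapD_disjoint u v : (\forall x \ae mu, rep u x * rep v x = 0) ->
  dmap (u + v) = dmap u + dmap v.
Proof.
move=> uv; apply: rep_ext; have e1 := ae_and (dmapE (u + v)) (repD u v).
have e2 := ae_and (repD (dmap u) (dmap v)) (ae_and (dmapE u) (dmapE v)).
apply: filterS (ae_and uv (ae_and e1 e2)) => x [+ [[-> ->] [-> [-> ->]]]].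
by move=> /eqP; rewrite mulf_eq0 => /orP[] /eqP ->; rewrite ?addr0 ?add0r spow0 ?addr0 ?add0r.
Qed.

(** This is [spow_sub_le] with r = p - 1, carried to L^q: its last term |u - v|^(p-1) is pointwise
    |J(u - v)|, so [Lp_norm_le3] applies to [dmap u], [dmap v] and [dmap (u - v)]. *)
Lemma dmap_continuous u (e : R) : 0 < e ->
  exists2 s : R, 0 < s & forall v, `|u - v| <= s -> `|dmap u - dmap v| <= e.
Proof.
move=> e0.
(* [M] bounds |u|^(p-1) + |v|^(p-1) once |u - v| <= 1; [t] and [s] leave e / 2 to each term. *)
pose M := `|u| `^ (p - 1) + (`|u| + 1) `^ (p - 1).
have M0 : 0 <= M by rewrite addr_ge0 ?powR_ge0.
pose t := e / 2 / (M + 1).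
have t0 : 0 < t by rewrite !divr_gt0// ltr_wpDl.
have [K K0 HK] := spow_sub_le p10 t0.
pose s := (e / 2 / (K + 1)) `^ (p - 1)^-1.
have s0 : 0 < s by rewrite powR_gt0// !divr_gt0// ltr_wpDl.
have sE : s `^ (p - 1) = e / 2 / (K + 1).
  rewrite -powRrM mulVf ?gt_eqF// powRr1// ltW// !divr_gt0// ltr_wpDl//.
have m0 : 0 < Num.min 1 s by rewrite lt_min ltr01.
exists (Num.min 1 s) => // v; rewrite le_min => /andP[uv1 uvs].
have vu : `|v| <= `|u| + 1.
  by rewrite -[v](subrKC u) (le_trans (ler_normD _ _))// lerD2l distrC.
have : `|dmap u - dmap v| <= t * `|dmap u| + t * `|dmap v| + K * `|dmap (u - v)|.
  apply: Lp_norm_le3; rewrite ?(ltW t0)//.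
  have e1 := ae_and (repB (dmap u) (dmap v)) (ae_and (dmapE u) (dmapE v)).
  have e2 := ae_and (dmapE (u - v)) (repB u v).
  apply: filterS (ae_and e1 e2) => x [[-> [-> ->]] [-> ->]].
  by rewrite [in leRHS]norm_spow// [in leRHS]norm_spow// [in leRHS]norm_spow// -mulrDr.
move=> /le_trans; apply; rewrite !norm_dmap -mulrDr [leRHS]splitr lerD//.
  rewrite (@le_trans _ _ (t * M))//.
    rewrite ler_pM2l// lerD2l ge0_ler_powR ?nnegrE ?(ltW p10)//.
  rewrite /t mulrAC ler_pdivrMr ?ltr_wpDl// ler_pM2l ?divr_gt0// lerDl//.
rewrite (@le_trans _ _ (K * s `^ (p - 1)))//.
  by rewrite ler_wpM2l// ge0_ler_powR ?nnegrE ?(ltW p10) ?(ltW s0).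
by rewrite sE mulrCA -[leRHS]mulr1 ler_pM2l ?divr_gt0// ler_pdivrMr ?ltr_wpDl// mul1r lerDl.
Qed.

(** Uniform convexity without an explicit modulus: vectors whose midpoint is nearly as long as they
    are must be close. *)
Lemma Lp_cvx_defect (t : R) : 0 < t -> exists2 K : R, 0 <= K & forall u v,
  `|u - v| `^ p <= t * (`|u| `^ p + `|v| `^ p) +
    K * ((`|u| `^ p + `|v| `^ p) / 2 - `|2^-1 *: (u + v)| `^ p).
Proof.
move=> t0; have [K K0 HK] := cvx_defect_le p1 t0; exists K => // u v.
have iu := rep_integrable u; have iv := rep_integrable v.
have iuv := rep_integrable (2^-1 *: (u + v)).
pose s x := `|rep u x| `^ p + `|rep v x| `^ p.
have is_ : mu.-integrable setT (EFin \o s) by exact: (integrableD measurableT iu iv).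
have sE : `|u| `^ p + `|v| `^ p = \int[mu]_x s x by rewrite RintegralD// !Lp_normE.
pose m x := 2^-1 * s x - `|rep (2^-1 *: (u + v)) x| `^ p.
have is2 : mu.-integrable setT (EFin \o (fun x => 2^-1 * s x)).
  exact: (integrableZl measurableT 2^-1 is_).
have iZs := integrableZl measurableT t is_.
have im : mu.-integrable setT (EFin \o m).
  exact: (integrableB measurableT is2 iuv).
have iZm := integrableZl measurableT K im.
have mE : (`|u| `^ p + `|v| `^ p) / 2 - `|2^-1 *: (u + v)| `^ p = \int[mu]_x m x.
  by rewrite RintegralB// sE RintegralZl// Lp_normE mulrC.
rewrite mE sE -!RintegralZl// -RintegralD//.
rewrite Lp_normE; apply: ae_le_Rintegral.
- exact: rep_integrable.
- exact: (integrableD measurableT iZs iZm).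
- have e1 := ae_and (repB u v) (ae_and (repD u v) (repZ 2^-1 (u + v))).
  apply: filterS e1 => x [-> [e2 e3]].
  by rewrite /m e3 e2 [2^-1 * s x]mulrC [2^-1 * _]mulrC; exact: HK.
Qed.

End pairing.

Lemma dmapK (p : R) (p1 : 1 < p) (q : R) (q1 : 1 < q) (pq : p^-1 + q^-1 = 1)
  (u : Lp mu p1) : dmap p1 (dmap q1 u) = u.
Proof.
have qp : q^-1 + p^-1 = 1 by rewrite addrC.
apply: rep_ext; apply: filterS (ae_and (dmapE p1 qp (dmap q1 u)) (dmapE q1 pq u)).
move=> x [-> ->]; rewrite spowK ?subr_gt0//.
have -> : q - 1 = (p - 1)^-1.
  have h := @conj_exponentE _ p q; rewrite !gt_eqF ?(lt_trans ltr01)// in h.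
  have p10 : p - 1 != 0 by rewrite gt_eqF// subr_gt0.
  by apply: (mulfI p10); rewrite mulfV// mulrBr (h isT isT pq); lra.
by rewrite mulfV// gt_eqF// subr_gt0.
Qed.

End Duality.

(** * Uniform convexity and completeness of L^p *)

Section Completeness.
Context {R : realType}.

Lemma powR_continuous_at (r c e : R) : 0 < r -> 0 <= c -> 0 < e ->
  exists2 s : R, 0 < s & forall a, 0 <= a -> `|a - c| <= s -> `|a `^ r - c `^ r| <= e.
Proof.
move=> r0 c0 e0.
pose M := (c + 1) `^ r + c `^ r.
have M0 : 0 <= M by rewrite addr_ge0 ?powR_ge0.
pose t := e / 2 / (M + 1).
have t0 : 0 < t by rewrite !divr_gt0// ltr_wpDl.
have [K K0 HK] := spow_sub_le r0 t0.
pose s := (e / 2 / (K + 1)) `^ r^-1.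
have s0 : 0 < s by rewrite powR_gt0// !divr_gt0// ltr_wpDl.
have sE : s `^ r = e / 2 / (K + 1).
  by rewrite -powRrM mulVf ?gt_eqF// powRr1// ltW// !divr_gt0// ltr_wpDl//.
have m0 : 0 < Num.min 1 s by rewrite lt_min ltr01.
exists (Num.min 1 s) => // a a0; rewrite le_min => /andP[ac1 acs].
have := HK a c; rewrite !ge0_spow// => /le_trans; apply.
rewrite [leRHS]splitr lerD//.
  rewrite (@le_trans _ _ (t * M))//.
    rewrite ler_pM2l// lerD//; last by rewrite ger0_norm.
    rewrite ge0_ler_powR ?nnegrE ?(ltW r0) ?addr_ge0// ger0_norm//.
    by move: ac1; rewrite ler_norml => /andP[_]; rewrite lerBlDl.
  by rewrite /t mulrAC ler_pdivrMr ?ltr_wpDl// ler_pM2l ?divr_gt0// lerDl//.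
rewrite (@le_trans _ _ (K * s `^ r))//.
  by rewrite ler_wpM2l// ge0_ler_powR ?nnegrE ?(ltW r0) ?(ltW s0).
by rewrite sE mulrCA -[leRHS]mulr1 ler_pM2l ?divr_gt0// ler_pdivrMr ?ltr_wpDl// mul1r lerDl.
Qed.

Lemma geometric_step_cvg (f : nat -> R) (M : R) :
  (forall k, `|f k.+1 - f k| <= M * 2^-1 ^+ k) -> cvgn f.
Proof.
move=> fM; have -> : f = (fun n => f 0%N + series (telescope f) n).
  by apply/funext => n; rewrite -eq_sum_telescope.
apply: is_cvgD; first exact: is_cvg_cst.
apply: normed_cvg; apply: (@series_le_cvg _ _ (geometric M 2^-1)) => //.
- by move=> n /=.
- by move=> n; apply: le_trans (fM n).
- apply: is_cvg_geometric_series; by rewrite ger0_norm// invf_lt1// ltr1n.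
Qed.

Definition norm_cauchy (X : normedModType R) (u : nat -> X) := forall e : R, 0 < e ->
  exists N, forall m n, (N <= m)%N -> (N <= n)%N -> `|u m - u n| <= e.

Definition tends_to (X : normedModType R) (u : nat -> X) (l : X) := forall e : R, 0 < e ->
  exists N, forall n, (N <= n)%N -> `|u n - l| <= e.

Context d (T : measurableType d) (mu : {measure set T -> \bar R}).
Context (p : R) (p1 : 1 < p).

Let p0 : 0 < p. Proof. exact: lt_trans p1. Qed.

(** Serves both limits of the proof, the rescalings of [f] and the maximizing sequence of a
    functional: upper bounds on the norms and a lower bound on the midpoints force a small convexity
    defect. *)
Lemma unif_convex_cauchy (v : nat -> Lp mu p1) (c : R) : 0 <= c ->
  (forall e : R, 0 < e -> exists N, forall m n, (N <= m)%N -> (N <= n)%N ->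
     `|v n| <= c + e /\ 2 * c - e <= `|v m + v n|) ->
  norm_cauchy v.
Proof.
move=> c0 H eta eta0; pose h := eta `^ p.
have h0 : 0 < h by rewrite powR_gt0.
have cp0 : 0 <= c `^ p by exact: powR_ge0.
(* The p-th powers of two norms add up to at most 2 (c^p + 1) and the defect is at most 2 e'; [t]
   and [e'] make each contribution at most h / 2. *)
pose t := h / 4 / (c `^ p + 1).
have t0 : 0 < t by rewrite !divr_gt0// ltr_wpDl.
have tE : t * (c `^ p + 1) = h / 4 by rewrite divfK// gt_eqF// ltr_wpDl.
have [K K0 HK] := Lp_cvx_defect mu p1 t0.
pose e' := Num.min 1 (h / 4 / (K + 1)).
have e'0 : 0 < e' by rewrite lt_min ltr01/= !divr_gt0// ltr_wpDl.
have e'1 : e' <= 1 by rewrite ge_min lexx.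
have Ke' : K * e' <= h / 4.
  rewrite (@le_trans _ _ (K * (h / 4 / (K + 1))))//.
    by rewrite ler_wpM2l// ge_min lexx orbT.
  by rewrite mulrCA -[leRHS]mulr1 ler_pM2l ?divr_gt0// ler_pdivrMr ?ltr_wpDl// mul1r lerDl.
have [s s0 Hs] := powR_continuous_at p0 c0 e'0.
have [N HN] := H s s0; exists N => m n Nm Nn.
have [vn vmn] := HN m n Nm Nn; have [vm _] := HN n m Nn Nm.
have up (w : Lp mu p1) : `|w| <= c + s -> `|w| `^ p <= c `^ p + e'.
  move=> ws; apply: (@le_trans _ _ ((c + s) `^ p)).
    by rewrite ge0_ler_powR ?nnegrE ?(ltW p0) ?addr_ge0 ?(ltW s0).
  have := Hs (c + s); rewrite addrAC subrr add0r ger0_norm ?(ltW s0)// lexx.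
  rewrite addr_ge0 ?(ltW s0)// => /(_ isT isT).
  by rewrite ler_norml => /andP[_]; rewrite lerBlDl.
have lo : c `^ p - e' <= `|2^-1 *: (v m + v n)| `^ p.
  (* c - s / 2 may be negative, and monotonicity of the power needs nonnegative bases. *)
  pose c' := Num.max 0 (c - s / 2).
  have c'0 : 0 <= c' by rewrite le_max lexx.
  have c's : `|c' - c| <= s.
    rewrite /c'; have [hc|hc] := leP 0 (c - s / 2).
      by rewrite addrAC subrr add0r normrN ger0_norm; lra.
    by rewrite sub0r normrN ger0_norm//; lra.
  apply: (@le_trans _ _ (c' `^ p)).
    by have := Hs c' c'0 c's; rewrite ler_norml => /andP[+ _]; lra.
  rewrite ge0_ler_powR ?nnegrE ?(ltW p0)// normrZ ger0_norm//.
  by rewrite /c' ge_max mulr_ge0 ?invr_ge0//=; lra.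
suff : `|v m - v n| `^ p <= h.
  move=> H1; rewrite leNgt; apply/negP => /(@gt0_ltr_powR _ p p0).
  rewrite !nnegrE (ltW eta0) normr_ge0 => /(_ isT isT).
  by rewrite /= ltNge H1.
apply: le_trans (HK _ _) _.
have := up _ vm; have := up _ vn.
set A := `|v m| `^ p; set B := `|v n| `^ p; set C := `|_ *: _| `^ p in lo * => hB hA.
have h1 : t * (A + B) <= t * (2 * (c `^ p + 1)) by rewrite ler_pM2l//; lra.
have h2 : K * ((A + B) / 2 - C) <= K * (2 * e') by rewrite ler_wpM2l//; lra.
by lra.
Qed.

(* The series of the [(2^k |w (k+1) - w k|)^p] is integrable, so almost everywhere
   the increments are bounded by a multiple of [2^-k]. *)
Lemma Lp_ae_limit (w : nat -> Lp mu p1) :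
  (forall k, `|w k.+1 - w k| <= 4^-1 ^+ k) ->
  \forall x \ae mu, cvgn (fun k => rep (w k) x).
Proof.
move=> wk.
(* Of the decay 4^-k, one factor 2^-k is kept for the pointwise bound; the other makes the integrals
   summable. *)
pose c k x := (`|rep (w k.+1) x - rep (w k) x| * 2 ^+ k) `^ p.
have mc k : measurable_fun setT (c k).
  apply: (@measurableT_comp _ _ _ _ _ _ (@powR R ^~ p)) => //.
  apply: measurable_funM => //; apply: measurableT_comp => //.
  by apply: measurable_funB; exact: measurable_rep.
have intc k : (\int[mu]_x (c k x)%:E <= (2^-1 ^+ k)%:E)%E.
  pose z := 2 ^+ k *: (w k.+1 - w k).
  have -> : (\int[mu]_x (c k x)%:E = \int[mu]_x (`|rep z x| `^ p)%:E)%E.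
    apply: ae_eq_integral => //.
    - exact/measurable_EFinP.
    - exact/measurable_EFinP/measurable_normr_powR/measurable_rep.
    - apply: filterS (ae_and (repZ (2 ^+ k) (w k.+1 - w k)) (repB (w k.+1) (w k))).
      by move=> x [e1 e2] _; rewrite /z e1 e2 /c normrM mulrC [`|2 ^+ k|]ger0_norm ?exprn_ge0.
  have zfin : (\int[mu]_x (`|rep z x| `^ p)%:E)%E \is a fin_num.
    by apply: integrable_fin_num => //; exact: rep_integrable.
  rewrite -(fineK zfin) lee_fin -[fine _]Lp_normE.
  have z0 : `|z| <= 2^-1 ^+ k.
    rewrite normrZ ger0_norm ?exprn_ge0// (le_trans (ler_wpM2l _ (wk k))) ?exprn_ge0//.
    by rewrite -exprMn (_ : 2 * 4^-1 = 2^-1 :> R)//; field.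
  have k1 : 0 <= (2^-1 ^+ k : R) <= 1.
    by rewrite exprn_ge0//= exprn_ile1// invf_le1// ler1n.
  apply: (@le_trans _ _ ((2^-1 ^+ k) `^ p)).
    by rewrite ge0_ler_powR ?nnegrE ?(ltW p0)//; case/andP: k1.
  by apply: ge1r_powR; [rewrite exprn_gt0//=; case/andP: k1|exact: ltW].
have c0 k x : (0 <= (c k x)%:E)%E by rewrite lee_fin powR_ge0.
pose S x := (\sum_(0 <= k <oo) (c k x)%:E)%E.
have mS : measurable_fun setT S.
  apply: (@ge0_emeasurable_sum _ T R setT (fun k x => (c k x)%:E) xpredT).
    by move=> k x _ _.
  by move=> k _; exact/measurable_EFinP.
have S0 x : (0 <= S x)%E by apply: nneseries_ge0.
have iS : mu.-integrable setT S.
  apply/integrableP; split=> //.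
  under eq_integral do rewrite gee0_abs//.
  rewrite integral_nneseries//; last by move=> k; exact/measurable_EFinP.
  apply: (@le_lt_trans _ _ (\sum_(0 <= k <oo) (2^-1 ^+ k)%:E)%E).
    by apply: lee_nneseries => // k *; apply: integral_ge0.
  apply: le_lt_trans (ltry (1 / (1 - 2^-1) : R)); apply: lime_le.
    by apply: is_cvg_nneseries => k _ _; rewrite lee_fin exprn_ge0.
  apply: nearW => n; rewrite sumEFin lee_fin.
  have h1 : `|2^-1 : R| < 1 by rewrite ger0_norm// invf_lt1// ltr1n.
  have := @geometric_le_lim R n 1 2^-1 ler01 _ h1; rewrite invr_gt0 ltr0n => /(_ isT).
  apply: le_trans; rewrite le_eqVlt /series/=.
  by under [X in _ == X]eq_bigr do rewrite mul1r; rewrite eqxx.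
apply: filterS (integrable_ae measurableT iS) => x /(_ I) Sfin.
pose M := (fine (S x)) `^ p^-1.
apply: (@geometric_step_cvg _ M) => k.
rewrite exprVn ler_pdivlMr ?exprn_gt0//.
suff H : c k x <= fine (S x).
  have := @ge0_ler_powR _ p^-1 _ _ _ _ _ H; rewrite !nnegrE /c -powRrM mulfV ?gt_eqF//.
  rewrite powRr1 ?mulr_ge0 ?exprn_ge0//; apply.
  - by rewrite invr_ge0 ltW.
  - exact: powR_ge0.
  - exact: fine_ge0.
rewrite -lee_fin fineK//.
apply: le_trans (nneseries_lim_ge k.+1 _) => //.
by rewrite big_nat_recr//= leeDr// sume_ge0.
Qed.

(** Riesz-Fischer: a fast subsequence converges almost everywhere, and Fatou's lemma transfers the
    norm estimates to the limit. *)
Theorem Lp_complete (u : nat -> Lp mu p1) : norm_cauchy u -> exists l, tends_to u l.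
Proof.
move=> cu.
have /choice[N HN] k : exists N, forall m n, (N <= m)%N -> (N <= n)%N ->
    `|u m - u n| <= 4^-1 ^+ k.
  by apply: cu; rewrite exprn_gt0// invr_gt0.
(* The partial sums make [phi] nondecreasing with phi k >= N k; the summand [k] makes it tend to
   infinity. *)
pose phi k := (k + \sum_(i < k.+1) N i)%N.
have phiN k : (N k <= phi k)%N by rewrite /phi big_ord_recr/= addnA leq_addl.
have phiS k : (phi k <= phi k.+1)%N.
  rewrite /phi [in X in (_ <= X)%N]big_ord_recr/= addnA.
  by rewrite (leq_trans _ (leq_addr _ _))// leq_add2r.
pose w k := u (phi k).
have wk k : `|w k.+1 - w k| <= 4^-1 ^+ k.
  by apply: HN => //; exact: leq_trans (phiN k) (phiS k).
have wae := Lp_ae_limit wk.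
have wcvg (e : R) : 0 < e ->
    exists K, forall k m, (K <= m)%N -> (K <= k)%N -> `|w k - u m| <= e.
  move=> e0; have [K HK] := cu e e0; exists K => k m Km Kk.
  by apply: HK => //; rewrite (leq_trans Kk)// leq_addr.
(* The upper limit is measurable everywhere and agrees with the limit wherever that exists. *)
pose f x := fine (limn_esup (fun k => (rep (w k) x)%:E)).
have mf : measurable_fun setT f.
  apply: measurableT_comp => //; apply: measurable_fun_limn_esup => k.
  exact/measurable_EFinP/measurable_rep.
have fE : \forall x \ae mu, rep (w k) x @[k --> \oo] --> f x.
  apply: filterS wae => x wx.
  have : (rep (w k) x)%:E @[k --> \oo] --> (limn (fun k => rep (w k) x))%:E.
    by apply: cvg_EFin => //; exact: nearW.
  by move=> /cvg_limn_einf_sup[_ fE]; rewrite /f fE.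
have fatouP (v : Lp mu p1) (e : R) K : 0 <= e -> (forall k, (K <= k)%N -> `|w k - v| <= e) ->
    (\int[mu]_x (`|f x - rep v x| `^ p)%:E <= (e `^ p)%:E)%E.
  move=> e0 He.
  (* The shift by [K] makes the norm bound hold at every index, hence for the lower limit in Fatou's
     lemma. *)
  pose g k x := (`|rep (w (k + K)%N) x - rep v x| `^ p)%:E.
  have mg k : measurable_fun setT (g k).
    apply/measurable_EFinP/measurable_normr_powR.
    by apply: measurable_funB; exact: measurable_rep.
  have -> : (\int[mu]_x (`|f x - rep v x| `^ p)%:E = \int[mu]_x limn_einf (g ^~ x))%E.
    apply: ae_eq_integral => //.
    - apply/measurable_EFinP/measurable_normr_powR.
      by apply: measurable_funB => //; exact: measurable_rep.
    - have -> : (fun x => limn_einf (g ^~ x)) = (fun x => - limn_esup (fun k => - g k x))%E.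
        apply/funext => x; rewrite -limn_einfN; congr limn_einf.
        by apply/funext => k; exact/esym/oppeK.
      apply: measurableT_comp => //; apply: measurable_fun_limn_esup => k.
      exact: measurableT_comp.
    - apply: filterS fE => x fx _; symmetry.
      apply: (fst (cvg_limn_einf_sup _)); apply: cvg_EFin; first exact: nearW.
      have fxK : rep (w (k + K)%N) x @[k --> \oo] --> f x.
        by rewrite (cvg_shiftn K (fun k => rep (w k) x)).
      apply/cvgrPdist_le => /= r r0.
      have [s s0 Hs] := powR_continuous_at p0 (normr_ge0 (f x - rep v x)) r0.
      move/cvgrPdist_le : fxK => /(_ s s0); apply: filterS => k ks.
      rewrite distrC; apply: Hs => //; apply: le_trans (ler_dist_dist _ _) _.
      by rewrite opprB addrA subrK distrC.
  apply: le_trans (fatou _ _ _ _) _ => //; first by move=> k x _; rewrite lee_fin powR_ge0.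
  have gle k : (\int[mu]_x g k x <= (e `^ p)%:E)%E.
    have -> : (\int[mu]_x g k x = \int[mu]_x (`|rep (w (k + K)%N - v) x| `^ p)%:E)%E.
      apply: ae_eq_integral => //.
        exact/measurable_EFinP/measurable_normr_powR/measurable_rep.
      by apply: filterS (repB (w (k + K)%N) v) => x e1 _; rewrite e1.
    have zfin : (\int[mu]_x (`|rep (w (k + K)%N - v) x| `^ p)%:E)%E \is a fin_num.
      by apply: integrable_fin_num => //; exact: rep_integrable.
    rewrite -(fineK zfin) lee_fin -[fine _]Lp_normE.
    by rewrite ge0_ler_powR ?nnegrE ?(ltW p0)// He// leq_addl.
  rewrite limn_einf_lim; apply: lime_le; first exact: is_cvg_einfs.
  apply: nearW => n; apply: le_trans (gle n); apply: ereal_inf_lbound.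
  by exists n => /=.
have fv (v : Lp mu p1) (e : R) K : 0 <= e -> (forall k, (K <= k)%N -> `|w k - v| <= e) ->
    inLp mu p (fun x => f x - rep v x).
  move=> e0 He; split; first by apply: measurable_funB => //; exact: measurable_rep.
  apply/integrableP; split.
    apply/measurable_EFinP/measurable_normr_powR.
    by apply: measurable_funB => //; exact: measurable_rep.
  apply: le_lt_trans (ltry (e `^ p)); apply: le_trans (fatouP v e K e0 He).
  by under eq_integral do rewrite gee0_abs ?lee_fin ?powR_ge0//.
have [K HK] := wcvg 1 ltr01.
pose v := u K; have He k : (K <= k)%N -> `|w k - v| <= 1 by move=> ?; exact: HK.
(* Fatou's lemma shows p-integrability of the difference [f - v], so [l] is the class of this
   difference plus [v]. *)
pose l := toLp mu p1 (fun x => f x - rep v x) + v.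
have lE : \forall x \ae mu, rep l x = f x.
  have e1 := ae_and (toLpE p1 (fv v 1 K ler01 He))
    (repD (toLp mu p1 (fun x => f x - rep v x)) v).
  by apply: filterS e1 => x [h1 h2]; rewrite /l h2 h1 subrK.
exists l => e e0; have [K' HK'] := wcvg e e0; exists K' => m mK.
have := fatouP (u m) e K' (ltW e0) (fun k kK => HK' k m mK kK).
have -> : (\int[mu]_x (`|f x - rep (u m) x| `^ p)%:E =
           \int[mu]_x (`|rep (l - u m) x| `^ p)%:E)%E.
  apply: ae_eq_integral => //.
  - apply/measurable_EFinP/measurable_normr_powR.
    by apply: measurable_funB => //; exact: measurable_rep.
  - exact/measurable_EFinP/measurable_normr_powR/measurable_rep.
  - by apply: filterS (ae_and lE (repB l (u m))) => x [h1 h2] _; rewrite h2 h1.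
have zfin : (\int[mu]_x (`|rep (l - u m) x| `^ p)%:E)%E \is a fin_num.
  by apply: integrable_fin_num => //; exact: rep_integrable.
rewrite -(fineK zfin) lee_fin -[fine _]Lp_normE distrC => H1.
rewrite leNgt; apply/negP => /(@gt0_ltr_powR _ p p0).
rewrite !nnegrE (ltW e0) normr_ge0 => /(_ isT isT).
by rewrite /= ltNge H1.
Qed.

End Completeness.

(** * Riesz representation on L^p *)

Section Riesz.
Context d (T : measurableType d) (R : realType) (mu : {measure set T -> \bar R}).
Context (p : R) (p1 : 1 < p) (q : R) (q1 : 1 < q) (pq : p^-1 + q^-1 = 1).
Let p0 : 0 < p. Proof. exact: lt_trans p1. Qed.

Lemma ler_epsM (a b K : R) : 0 <= K -> (forall e, 0 < e -> a <= b + K * e) -> a <= b.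
Proof.
move=> K0 H; apply/ler_addgt0Pr => e e0.
have K1 : 0 < K + 1 by rewrite ltr_wpDl.
apply: le_trans (H (e / (K + 1)) (divr_gt0 e0 K1)) _; rewrite lerD2l.
by rewrite mulrCA -[leRHS]mulr1 ler_pM2l// ler_pdivrMr// mul1r lerDl.
Qed.

(* The support functional at [l] is [pairing (dmap l)]: a functional dominated
   by a multiple of the norm and attaining it at [l] is proportional to it. *)
Lemma norm_attaining_functional (L : Lp mu p1 -> R) (c : R) (l : Lp mu p1) :
  {morph L : u v / u + v} -> (forall a u, L (a *: u) = a * L u) ->
  0 <= c -> (forall u, L u <= c * `|u|) -> `|l| = 1 -> L l = c ->
  forall w, L w <= c * pairing (dmap q1 l) w.
Proof.
move=> LD LZ c0 Lc l1 Ll w; apply: (@ler_epsM _ _ (`|L w| + c * `|w|)).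
  by rewrite addr_ge0// mulr_ge0.
move=> e e0.
have [s s0 Hs] := dmap_continuous q1 pq l e0.
pose r := s / (`|w| + 1).
have w1 : 0 < `|w| + 1 by rewrite ltr_wpDl.
have r0 : 0 < r by rewrite divr_gt0.
pose z := l + r *: w.
have lz : `|l - z| <= s.
  rewrite /z opprD addrA subrr add0r normrN normrZ ger0_norm ?(ltW r0)//.
  by rewrite /r mulrAC ler_pdivrMr// ler_pM2l// lerDl.
have dz := Hs z lz.
have nz : `| `|z| `^ (p - 1) - 1| <= e.
  have := le_trans (ler_dist_dist (dmap q1 l) (dmap q1 z)) dz.
  by rewrite !norm_dmap// l1 onepowR distrC.
have pz : `|pairing (dmap q1 z) w - pairing (dmap q1 l) w| <= e * `|w|.
  rewrite -(pairingBl pq); apply: le_trans (pairing_le pq _ _) _.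
  by rewrite ler_wpM2r// distrC.
have Lz : L z = c + r * L w by rewrite LD LZ Ll.
(* Expanding <Jz, z> at z = l + r w and using L z <= c |z| gives |z|^(p-1) L w <= c <Jz, w>.
   Continuity of [dmap] at [l] then replaces Jz by Jl and |z|^(p-1) by 1, up to errors of order
   [e]. *)
have zp : `|z| `^ p <= `|z| `^ (p - 1) + r * pairing (dmap q1 z) w.
  rewrite -(pairing_dmap q1 pq) {2}/z (pairingDr pq) (pairingZr pq) lerD2r.
  apply: le_trans (ler_norm _) _; apply: le_trans (pairing_le pq _ _) _.
  by rewrite l1 mulr1 norm_dmap.
have h : `|z| `^ (p - 1) * (c + r * L w) <= c * (`|z| `^ (p - 1) + r * pairing (dmap q1 z) w).
  apply: le_trans (ler_wpM2l c0 zp); rewrite -Lz.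
  apply: le_trans (ler_wpM2l (powR_ge0 _ _) (Lc z)) _.
  by rewrite mulrCA [_ * `|z|]mulrC mulr_powRB1.
have {}h : `|z| `^ (p - 1) * L w <= c * pairing (dmap q1 z) w.
  rewrite -(ler_pM2l r0); move: h; rewrite !mulrDr [c * _]mulrC lerD2l.
  by rewrite mulrCA [c * (r * _)]mulrCA.
have h1 : (1 - `|z| `^ (p - 1)) * L w <= e * `|L w|.
  apply: le_trans (ler_norm _) _; rewrite normrM ler_wpM2r// distrC//.
have h2 : c * (pairing (dmap q1 z) w - pairing (dmap q1 l) w) <= c * (e * `|w|).
  by rewrite ler_wpM2l// (le_trans (ler_norm _)).
move: h1 h2; rewrite mulrBl mul1r mulrBr => h1 h2.
rewrite mulrDl [`|L w| * e]mulrC -mulrA [`|w| * e]mulrC.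
by lra.
Qed.

(* By uniform convexity a maximizing sequence on the unit ball converges, and the
   functional is represented by its limit, whence no sigma-finiteness assumption. *)
Theorem Lp_riesz (L : Lp mu p1 -> R) (C : R) :
  {morph L : u v / u + v} -> (forall a u, L (a *: u) = a * L u) ->
  (forall u, `|L u| <= C * `|u|) ->
  exists z : Lp mu q1, forall u, L u = pairing z u.
Proof.
move=> LD LZ LC.
have L0 : L 0 = 0 by rewrite -(scale0r 0) LZ mul0r.
have LN u : L (- u) = - L u by rewrite -scaleN1r LZ mulN1r.
have LB u v : L (u - v) = L u - L v by rewrite LD LN.
pose E := [set L u | u in [set u : Lp mu p1 | `|u| <= 1]].
have E0 : E 0 by exists 0 => //=; rewrite normr0.
have Esup : has_sup E.
  split; first by exists 0.
  exists `|C| => _ [u /= u1 <-]; apply: le_trans (ler_norm _) _.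
  apply: le_trans (LC u) _; apply: le_trans (ler_norm _) _.
  by rewrite normrM normr_id ler_piMr.
pose c := sup E.
have c0 : 0 <= c by exact: sup_upper_bound.
have Lc u : L u <= c * `|u|.
  have [->|u0] := eqVneq u 0; first by rewrite L0 normr0 mulr0.
  have nu0 : 0 < `|u| by rewrite normr_gt0.
  rewrite -ler_pdivrMr// mulrC -LZ; apply: sup_upper_bound => //.
  exists (`|u|^-1 *: u) => //=.
  by rewrite normrZ ger0_norm ?invr_ge0// mulVf// gt_eqF.
have [cE|cn0] := eqVneq c 0.
  exists 0 => u; rewrite -(scale0r (0 : Lp mu q1)) (pairingZl pq) mul0r.
  apply/eqP; rewrite eq_le; have := Lc u; have := Lc (- u).
  by rewrite LN cE !mul0r lerNl oppr0 => -> ->.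
have {cn0}cpos : 0 < c by rewrite lt_neqAle eq_sym cn0.
(* A maximizing sequence in the unit ball: L(u m + u n) is close to 2c, so |u m + u n| is close to
   2. *)
have /choice[u Hu] n : exists u : Lp mu p1, `|u| <= 1 /\ c - c / n.+1%:R <= L u.
  have e0 : 0 < c / n.+1%:R by rewrite divr_gt0.
  have [_ [u /= u1 <-] cu] := sup_adherent e0 Esup.
  by exists u; split=> //; exact: ltW.
have small (e : R) : 0 < e -> exists N, forall n, (N <= n)%N -> n.+1%:R^-1 <= e.
  move=> e0; exists (Num.truncn e^-1) => n nN.
  rewrite invf_ple ?posrE//; apply: ltW.
  have := @truncn_itv _ e^-1 (ltW _); rewrite invr_gt0 => /(_ e0)/andP[_ h].
  by apply: lt_le_trans h _; rewrite ler_nat ltnS.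
have ucau : norm_cauchy u.
  apply: (@unif_convex_cauchy _ _ _ _ _ _ u 1) => // e e0.
  have [N HN] := small (e / 2) (divr_gt0 e0 (ltr0n _ 2)).
  exists N => m n Nm Nn; split.
    by have [+ _] := Hu n => /le_trans; apply; rewrite lerDl ltW.
  rewrite -(ler_pM2l cpos) (le_trans _ (Lc _))// LD.
  have [_ hm] := Hu m; have [_ hn] := Hu n.
  have h1 : c / m.+1%:R <= c * (e / 2) by rewrite ler_pM2l// HN.
  have h2 : c / n.+1%:R <= c * (e / 2) by rewrite ler_pM2l// HN.
  move: h1 h2 hm hn; set a := c / m.+1%:R; set b := c / n.+1%:R.
  rewrite mulr1 mulrBr; set ce := c * (e / 2).
  have -> : c * e = 2 * ce by rewrite /ce mulrCA [2 * _]mulrC divfK.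
  by lra.
have [l Hl] := Lp_complete ucau.
have l1 : `|l| <= 1.
  apply/ler_addgt0Pr => e e0; have [N HN] := Hl e e0.
  rewrite -[l](subKr (u N)) (le_trans (ler_normB _ _))// lerD ?HN//.
  by have [] := Hu N.
have Ll : L l = c.
  apply/eqP; rewrite eq_le; apply/andP; split; first by apply: sup_upper_bound => //; exists l.
  apply: (@ler_epsM _ _ (2 * c)); first by rewrite mulr_ge0.
  move=> e e0; have [N1 HN1] := Hl e e0; have [N2 HN2] := small e e0.
  pose n := (N1 + N2)%N.
  have h1 := HN1 n (leq_addr _ _); have h2 := HN2 n (leq_addl _ _).
  have [_ h3] := Hu n.
  have h4 := Lc (u n - l); rewrite LB in h4.
  have h5 : c * `|u n - l| <= c * e by rewrite ler_pM2l.
  have h6 : c / n.+1%:R <= c * e by rewrite ler_pM2l.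
  move: h3 h5 h6; rewrite -mulrA; set a := c / _; set b := c * e => h3 h5 h6.
  by lra.
have l1' : `|l| = 1.
  apply/eqP; rewrite eq_le l1/=; have := Lc l.
  by rewrite Ll -{1}(mulr1 c) ler_pM2l.
exists (c *: dmap q1 l) => w; rewrite (pairingZl pq).
apply/eqP; rewrite eq_le; apply/andP; split.
  exact: (norm_attaining_functional LD LZ).
have := norm_attaining_functional LD LZ c0 Lc l1' Ll (- w).
by rewrite LN (pairingNr pq) mulrN lerN2.
Qed.

End Riesz.

(** * Clarkson's inequality and disjointness of supports *)

Definition disjointLp (R : realType) d (T : measurableType d)
    (mu : {measure set T -> \bar R}) (p : R) (p1 : 1 < p) (u v : Lp mu p1) :=
  \forall x \ae mu, rep u x * rep v x = 0.

Section Disjointness.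
Context {R : realType} (p : R) (p1 : 1 < p).
Let p0 : 0 < p. Proof. exact: lt_trans p1. Qed.

Section clarkson.
Context d (T : measurableType d) (mu : {measure set T -> \bar R}).

Lemma clarkson_integral (u v : Lp mu p1) :
  mu.-integrable setT (EFin \o (fun x => clarkson p (rep u x) (rep v x))) /\
  \int[mu]_x clarkson p (rep u x) (rep v x) =
  `|u + v| `^ p + `|u - v| `^ p - 2 * (`|u| `^ p + `|v| `^ p).
Proof.
pose F x := `|rep (u + v) x| `^ p + `|rep (u - v) x| `^ p.
pose G x := 2 * (`|rep u x| `^ p + `|rep v x| `^ p).
have i0 := integrableD measurableT (rep_integrable u) (rep_integrable v).
have iF : mu.-integrable setT (EFin \o F).
  exact: (integrableD measurableT (rep_integrable _) (rep_integrable _)).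
have iG : mu.-integrable setT (EFin \o G) by exact: (integrableZl measurableT 2 i0).
have iFG : mu.-integrable setT (EFin \o (fun x => F x - G x)).
  exact: (integrableB measurableT iF iG).
have mFG : measurable_fun setT (fun x => F x - G x).
  by have /integrableP[/measurable_EFinP] := iFG.
have mc : measurable_fun setT (fun x => clarkson p (rep u x) (rep v x)).
  apply: measurable_funB.
    by apply: measurable_funD; apply: measurable_normr_powR;
      [apply: measurable_funD|apply: measurable_funB]; exact: measurable_rep.
  apply: measurable_funM => //.
  by apply: measurable_funD; exact/measurable_normr_powR/measurable_rep.
have e : \forall x \ae mu, F x - G x = clarkson p (rep u x) (rep v x).
  by apply: filterS (ae_and (repD u v) (repB u v)) => x [h1 h2]; rewrite /F h1 h2.
split; first exact: (ae_eq_integrable mFG mc e).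
rewrite -(ae_eq_Rintegral mFG mc e) RintegralB// RintegralD//; try exact: rep_integrable.
rewrite RintegralZl// RintegralD//; try exact: rep_integrable.
by rewrite !Lp_normE.
Qed.

Lemma clarkson_disjoint (a b : R) : a * b = 0 -> clarkson p a b = 0.
Proof.
move=> /eqP; rewrite mulf_eq0 /clarkson => /orP[] /eqP ->.
  by rewrite add0r sub0r normrN normr0 powR0 ?gt_eqF//; ring.
by rewrite addr0 subr0 normr0 powR0 ?gt_eqF//; ring.
Qed.

(** Expresses disjointness by norms of sums and differences, which linear isometries preserve. The
    integrand has one sign, depending on the side of 2 on which [p] lies, so a zero integral makes
    it zero almost everywhere. *)
Lemma clarkson_disjointP (u v : Lp mu p1) : p != 2 -> disjointLp u v <->
  `|u + v| `^ p + `|u - v| `^ p = 2 * (`|u| `^ p + `|v| `^ p).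
Proof.
move=> p2; have [ci cE] := clarkson_integral u v.
have mc : measurable_fun setT (fun x => clarkson p (rep u x) (rep v x)).
  by have /integrableP[/measurable_EFinP] := ci.
split=> [uv|uv].
  apply/eqP; rewrite -subr_eq0 -cE.
  rewrite (@ae_eq_Rintegral _ _ _ _ _ (cst 0))//.
    by rewrite Rintegral_cst// mul0r.
  by apply: filterS uv => x /clarkson_disjoint.
have mEc : measurable_fun setT (fun x => (clarkson p (rep u x) (rep v x))%:E).
  exact/measurable_EFinP.
have {uv} : \int[mu]_x clarkson p (rep u x) (rep v x) = 0 by rewrite cE uv subrr.
have cfin : (\int[mu]_x (clarkson p (rep u x) (rep v x))%:E)%E \is a fin_num.
  exact: integrable_fin_num.
move=> c0.
have {c0}c0 : (\int[mu]_x (clarkson p (rep u x) (rep v x))%:E = 0)%E.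
  by rewrite -(fineK cfin); congr EFin.
have [/clarkson_gt2 cp|/clarkson_lt2 cp] : 2 < p \/ p < 2.
  by move: p2; rewrite neq_lt => /orP[]; [right|left].
- have : (\int[mu]_x `|(clarkson p (rep u x) (rep v x))%:E| = 0)%E.
    rewrite -[RHS]c0; apply: eq_integral => x _.
    by rewrite gee0_abs// lee_fin; case: (cp (rep u x) (rep v x)).
  move/(ae_eq_integral_abs mu measurableT mEc).
  apply: filterS => x /(_ I) [] h; by case: (cp (rep u x) (rep v x)) => _; apply.
- have : (\int[mu]_x `|(clarkson p (rep u x) (rep v x))%:E| = 0)%E.
    transitivity (\int[mu]_x (- (clarkson p (rep u x) (rep v x))%:E))%E.
      apply: eq_integral => x _.
      by rewrite lee0_abs// lee_fin; case: (cp (rep u x) (rep v x) p1).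
    rewrite integralN ?c0 ?oppe0//; exact: integrable_add_def.
  move/(ae_eq_integral_abs mu measurableT mEc).
  apply: filterS => x /(_ I) [] h; by case: (cp (rep u x) (rep v x) p1) => _; apply.
Qed.

End clarkson.

Lemma isometry_disjoint d1 (T1 : measurableType d1) (mu1 : {measure set T1 -> \bar R})
    d2 (T2 : measurableType d2) (mu2 : {measure set T2 -> \bar R})
    (U : Lp mu1 p1 -> Lp mu2 p1) (u v : Lp mu1 p1) : p != 2 ->
  {morph U : x y / x + y} -> (forall x, `|U x| = `|x|) ->
  disjointLp u v -> disjointLp (U u) (U v).
Proof.
move=> p2 UD Un /(clarkson_disjointP _ _ p2) uv; apply/(clarkson_disjointP _ _ p2).
have U0 : U 0 = 0 by apply/normr0_eq0; rewrite Un normr0.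
have UN x : U (- x) = - U x.
  by apply/eqP; rewrite -subr_eq0 opprK -UD addNr U0.
by rewrite -UN -!UD !Un.
Qed.

End Disjointness.

(** * Additivity from additivity on disjoint functions *)

Section DisjointAdditivity.
Context d (T : measurableType d) (R : realType) (mu : {measure set T -> \bar R}).
Context (p : R) (p1 : 1 < p).
Notation X := (Lp mu p1).
Implicit Types (u v w : X) (h k : T -> R).

(** Brings the quotients of [disjoint_additive] under [measurable_spow_rep]. *)
Lemma spow_inv (x : R) : spow (-1) x = x^-1.
Proof. by rewrite /spow powR_inv1// -normfV -{1}(invrK x) sgrV -numEsg. Qed.

Definition mulLp h u : X := toLp mu p1 (fun x => h x * rep u x).

Lemma measurable_indicator (P : T -> bool) : measurable [set x | P x] ->
  measurable_fun setT (fun x => (P x)%:R : R).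
Proof.
move=> mP; rewrite (_ : (fun x => (P x)%:R) = \1_[set x | P x]).
  exact: measurable_indic.
apply/funext => x; rewrite indicE; congr (_%:R); congr nat_of_bool.
by apply/idP/idP => [Px|/set_mem]; first exact: mem_set.
Qed.

Lemma norm_indicator_le1 (b : bool) : `|b%:R : R| <= 1.
Proof. by case: b; rewrite ?normr1 ?normr0. Qed.

Lemma mulLpE h u (C : R) : measurable_fun setT h -> (forall x, `|h x| <= C) ->
  \forall x \ae mu, rep (mulLp h u) x = h x * rep u x.
Proof.
move=> mh hC; apply: toLpE.
have Cu : inLp mu p (fun x => C * rep u x).
  split; first by apply: measurable_funM => //; exact: measurable_rep.
  rewrite (_ : (fun x => `|C * rep u x| `^ p) = (fun x => `|C| `^ p * `|rep u x| `^ p)).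
    exact: (integrableZl measurableT _ (rep_integrable u)).
  by apply/funext => x; rewrite normrM powRM.
apply: (inLp_le p1 _ Cu) => [|x].
  by apply: measurable_funM => //; exact: measurable_rep.
by rewrite !normrM ler_wpM2r// (le_trans (hC x))// ler_norm.
Qed.

(** Grid of step 1 / (n + 1) on [-1, 1], shifted by 1 so that cells are indexed by natural numbers.
    The endpoint t = 1 falls in cell 2 (n + 1), hence one extra cell in the count. *)
Lemma step_approx (n : nat) (t : R) : `|t| <= 1 ->
  exists2 j0, (j0 < (n.+1 * 2).+1)%N &
    (forall j : nat, (j%:R <= (t + 1) * n.+1%:R < j.+1%:R) = (j == j0)) /\
    `|j0%:R / n.+1%:R - 1 - t| <= n.+1%:R^-1.
Proof.
rewrite ler_norml => /andP[t1 t2].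
have n0 : 0 < n.+1%:R :> R by rewrite ltr0n.
have y0 : 0 <= (t + 1) * n.+1%:R by rewrite mulr_ge0//; lra.
exists (Num.truncn ((t + 1) * n.+1%:R)).
  rewrite ltnS -(@ler_nat R); have /andP[h _] := truncn_itv y0; apply: le_trans h _.
  by rewrite natrM mulrC ler_pM2l//; lra.
split; first by move=> j; rewrite -truncn_eq// eq_sym.
have /andP[h1 h2] := truncn_itv y0; move: h1 h2.
set j := Num.truncn _ => h1 h2.
have -> : j%:R / n.+1%:R - 1 - t = (j%:R - (t + 1) * n.+1%:R) / n.+1%:R.
  by field; rewrite gt_eqF.
rewrite normrM [`|_^-1|]ger0_norm ?invr_ge0// ler_piMl ?invr_ge0//.
by rewrite ler_norml; move: h2; rewrite -natr1; lra.
Qed.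

Context (L : X -> R).
Context (LZ : forall a u, L (a *: u) = a * L u).
Context (LD_disjoint : forall u v, disjointLp u v -> L (u + v) = L u + L v).
Context (L_continuous : forall u (e : R), 0 < e ->
  exists2 s : R, 0 < s & forall v, `|u - v| <= s -> `|L u - L v| <= e).

Lemma disjointLpZ a u v : disjointLp u v -> disjointLp u (a *: v).
Proof.
move=> uv; apply: filterS (ae_and uv (repZ a v)) => x [h1 h2].
by rewrite h2 mulrCA h1 mulr0.
Qed.

Lemma disjointLp_sum n (c : nat -> R) (z : nat -> X) u :
  (forall j, (j < n)%N -> disjointLp (z j) u) ->
  disjointLp (\sum_(j < n) c j *: z j) u.
Proof.
elim: n => [|n IHn] zu.
  by rewrite big_ord0; apply: filterS (rep0 mu p1) => x ->; rewrite mul0r.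
rewrite big_ord_recr/=; set S := \sum_(j < n) _.
have h1 : disjointLp S u by apply: IHn => j jn; apply: zu; exact: ltnW.
have h2 := zu n (ltnSn n).
apply: filterS (ae_and (ae_and h1 h2) (ae_and (repD S (c n *: z n)) (repZ (c n) (z n)))).
by move=> x [[e1 e2] [e3 e4]]; rewrite e3 e4 mulrDl e1 -mulrA e2 mulr0 addr0.
Qed.

Lemma L_sum_disjoint n (c : nat -> R) (z : nat -> X) :
  (forall i j, i != j -> disjointLp (z i) (z j)) ->
  L (\sum_(j < n) c j *: z j) = \sum_(j < n) c j * L (z j).
Proof.
move=> zz; elim: n => [|n IHn].
  by rewrite !big_ord0 -(scale0r (0 : X)) LZ mul0r.
rewrite !big_ord_recr/= LD_disjoint ?IHn ?LZ//.
apply: disjointLpZ; apply: disjointLp_sum => j jn.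
by apply: zz; rewrite ltn_eqF.
Qed.

Lemma rep_sum n (c : nat -> R) (z : nat -> X) (g : nat -> T -> R) :
  (forall j, \forall x \ae mu, rep (z j) x = g j x) ->
  \forall x \ae mu, rep (\sum_(j < n) c j *: z j) x = \sum_(j < n) c j * g j x.
Proof.
move=> zg; elim: n => [|n IHn].
  by rewrite big_ord0; apply: filterS (rep0 mu p1) => x ->; rewrite big_ord0.
rewrite big_ord_recr/=; set S := \sum_(j < n) _ in IHn *.
apply: filterS (ae_and (ae_and IHn (zg n)) (ae_and (repD S (c n *: z n)) (repZ (c n) (z n)))).
by move=> x [[e1 e2] [e3 e4]]; rewrite big_ord_recr/= e3 e4 e1 e2.
Qed.

(* [h] is approximated uniformly by functions constant on the pieces of a finite
   partition; on the corresponding pieces of [w] use [LD_disjoint]. *)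
Lemma L_addM h w : measurable_fun setT h -> (forall x, `|h x| <= 1) ->
  L (w + mulLp h w) = L w + L (mulLp h w).
Proof.
move=> mh h1.
have hwE := mulLpE w mh h1; set hw := mulLp h w in hwE *.
have key (n : nat) : exists2 v, `|v - hw| <= n.+1%:R^-1 * `|w| & L (w + v) = L w + L v.
  pose A (j : nat) x := j%:R <= (h x + 1) * n.+1%:R < j.+1%:R.
  have mA j : measurable_fun setT (fun x => (A j x)%:R : R).
    have mg : measurable_fun setT (fun x => (h x + 1) * n.+1%:R).
      by apply: measurable_funM => //; exact: measurable_funD.
    apply: measurable_indicator.
    rewrite (_ : [set x | A j x] =
      setT `&` (fun x => (h x + 1) * n.+1%:R) @^-1` `[j%:R, j.+1%:R[%classic).
      exact: mg.
    by apply/seteqP; split=> x /=; rewrite in_itv/=; [|case].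
  pose z j := mulLp (fun x => (A j x)%:R) w.
  have zE j : \forall x \ae mu, rep (z j) x = (A j x)%:R * rep w x.
    by apply: (@mulLpE _ _ 1) => // x; exact: norm_indicator_le1.
  pose c (j : nat) : R := j%:R / n.+1%:R - 1.
  pose N := (n.+1 * 2).+1.
  have zz i j : i != j -> disjointLp (z i) (z j).
    move=> ij; apply: filterS (ae_and (zE i) (zE j)) => x [-> ->].
    have [j0 _ [Hj0 _]] := step_approx n (h1 x).
    rewrite /A !Hj0; have [ie|_] := eqVneq i j0; last by rewrite !mul0r.
    have [je|_] := eqVneq j j0; last by rewrite !mul0r mulr0.
    by move: ij; rewrite ie je eqxx.
  (* At each point exactly one indicator [A j] is 1. The weights [c'] stay free: weights 1 recover
     [w], weights [c] give [v]. *)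
  have cE (c' : nat -> R) x : exists2 j0 : nat,
      \sum_(j < N) c' j * ((A j x)%:R * rep w x) = c' j0 * rep w x &
      `|c j0 - h x| <= n.+1%:R^-1.
    have [j0 j0N [Hj0 cj0]] := step_approx n (h1 x); exists j0 => //.
    rewrite (bigD1 (Ordinal j0N))//= big1 ?addr0 => [|j jj0].
      by rewrite /A Hj0 eqxx mul1r.
    rewrite /A Hj0 (_ : (j == j0 :> nat) = false) ?mul0r ?mulr0//.
    by apply/negP => /eqP e; move/negP: jj0; apply; apply/eqP/val_inj.
  pose v := \sum_(j < N) c j *: z j.
  have wE : w = \sum_(j < N) 1 *: z j.
    apply: rep_ext; apply: filterS (rep_sum N (fun=> 1) zE) => x ->.
    by have [j0 -> _] := cE (fun=> 1) x; rewrite mul1r.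
  have vE := rep_sum N c zE; rewrite -/v in vE.
  exists v.
    have : `|v - hw| <= n.+1%:R^-1 * `|w| + 0 * `|w| + 0 * `|w|.
      apply: Lp_norm_le3; rewrite ?invr_ge0//.
      apply: filterS (ae_and (repB v hw) (ae_and vE hwE)) => x [-> [-> ->]].
      have [j0 -> cj0] := cE c x.
      by rewrite -mulrBl normrM !mul0r !addr0 ler_wpM2r.
    by rewrite !mul0r !addr0.
  (* [w + v] is a combination of the same disjoint pieces, with weights 1 + c j. *)
  rewrite {1 2}wE -big_split/=.
  under eq_bigr do rewrite -scalerDl.
  rewrite (L_sum_disjoint N (fun j => 1 + c j) zz) (L_sum_disjoint N (fun=> 1) zz).
  rewrite (L_sum_disjoint N c zz) -big_split/=.
  by apply: eq_bigr => j _; rewrite mulrDl.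
have close (e a b c x : R) : `|a - (c + x)| <= e -> `|b - x| <= e -> `|a - (c + b)| <= 2 * e.
  by rewrite !ler_norml => /andP[? ?] /andP[? ?]; apply/andP; split; lra.
have main (e : R) : 0 < e -> `|L (w + hw) - (L w + L hw)| <= 2 * e.
  move=> e0.
  have [s1 s10 H1] := L_continuous (w + hw) e0.
  have [s2 s20 H2] := L_continuous hw e0.
  pose s := Num.min s1 s2.
  have s0 : 0 < s by rewrite lt_min s10.
  pose n := Num.truncn (`|w| / s).
  have nw : n.+1%:R^-1 * `|w| <= s.
    rewrite mulrC ler_pdivrMr ?ltr0n// -ler_pdivrMl// mulrC.
    by have /andP[_ /ltW] := truncn_itv (divr_ge0 (normr_ge0 w) (ltW s0)).
  have [v vh Lv] := key n.
  have vs : `|hw - v| <= s by rewrite distrC (le_trans vh).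
  have h3 : `|L (w + hw) - L (w + v)| <= e.
    by apply: H1; rewrite opprD addrACA subrr add0r (le_trans vs)// ge_min lexx.
  have h4 : `|L hw - L v| <= e by apply: H2; rewrite (le_trans vs)// ge_min lexx orbT.
  by rewrite Lv in h3; exact: close h3 h4.
apply/eqP; rewrite -subr_eq0 -normr_le0; apply: (@ler_epsM _ _ _ 2) => // e e0.
by rewrite add0r main.
Qed.

(* Where [|w2| <= |w1|] one has [w2 = h w1] with [|h| <= 1], and symmetrically
   elsewhere. *)
Theorem disjoint_additive : {morph L : u v / u + v}.
Proof.
move=> w1 w2.
pose b x := `|rep w2 x| <= `|rep w1 x|.
have mb : measurable_fun setT b.
  by apply: measurable_fun_ler; apply: measurableT_comp => //; exact: measurable_rep.
pose f x := (b x)%:R : R. pose g x := (~~ b x)%:R : R.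
have mf : measurable_fun setT f.
  apply: measurable_indicator; rewrite -[X in measurable X]setTI.
  exact: (mb measurableT [set true]).
have mg : measurable_fun setT g.
  rewrite (_ : g = fun x => 1 - f x); first exact: measurable_funB.
  by apply/funext => x; rewrite /g /f; case: (b x); rewrite ?subrr ?subr0.
have f1 x : `|f x| <= 1 by exact: norm_indicator_le1.
have g1 x : `|g x| <= 1 by exact: norm_indicator_le1.
pose h x := f x * (rep w2 x * spow (-1) (rep w1 x)).
pose k x := g x * (rep w1 x * spow (-1) (rep w2 x)).
have mh : measurable_fun setT h.
  apply: measurable_funM => //; apply: measurable_funM; first exact: measurable_rep.
  exact: measurable_spow_rep.
have mk : measurable_fun setT k.
  apply: measurable_funM => //; apply: measurable_funM; first exact: measurable_rep.
  exact: measurable_spow_rep.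
have quot_le1 (a c : R) : `|a| <= `|c| -> `|a * spow (-1) c| <= 1.
  rewrite spow_inv normrM normfV => ac; have [->|c0] := eqVneq c 0.
    by rewrite normr0 invr0 mulr0.
  by rewrite ler_pdivrMr ?normr_gt0// mul1r.
(* A zero denominator forces a zero numerator, so the convention 0^-1 = 0 does no harm. *)
have quotK (a c : R) : `|a| <= `|c| -> a * spow (-1) c * c = a.
  rewrite spow_inv => ac; have [c0|c0] := eqVneq c 0; last by rewrite divfK.
  by move: ac; rewrite c0 normr0 normr_le0 => /eqP ->; rewrite !mul0r.
have h1 x : `|h x| <= 1.
  rewrite /h /f; have [bx|_] := boolP (b x); last by rewrite mul0r normr0.
  by rewrite mul1r; exact: quot_le1.
have k1 x : `|k x| <= 1.
  rewrite /k /g; have [_|bx] := boolP (b x); first by rewrite mul0r normr0.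
  by rewrite mul1r; apply: quot_le1; move: bx; rewrite /b -ltNge => /ltW.
have split w : w = mulLp f w + mulLp g w /\ L w = L (mulLp f w) + L (mulLp g w).
  have e1 := ae_and (mulLpE w mf f1) (mulLpE w mg g1).
  have wE : w = mulLp f w + mulLp g w.
    apply: rep_ext.
    apply: filterS (ae_and (repD (mulLp f w) (mulLp g w)) e1) => x [-> [-> ->]].
    by rewrite -mulrDl /f /g; case: (b x); rewrite ?addr0 ?add0r mul1r.
  split=> //; rewrite {1}wE LD_disjoint//; apply: filterS e1 => x [-> ->].
  by rewrite /f /g; case: (b x); rewrite !mul0r ?mulr0.
have [w1E Lw1] := split w1; have [w2E Lw2] := split w2.
pose u := mulLp f w1. pose v := mulLp g w2.
have uE := mulLpE w1 mf f1; rewrite -/(mulLp f w1) -/u in uE.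
have vE := mulLpE w2 mg g1; rewrite -/(mulLp g w2) -/v in vE.
have fw2 : mulLp f w2 = mulLp h u.
  apply: rep_ext.
  apply: filterS (ae_and (mulLpE w2 mf f1) (ae_and (mulLpE u mh h1) uE)) => x [-> [-> ->]].
  rewrite /h /f; have [bx|_] := boolP (b x); last by rewrite !mul0r.
  by rewrite !mul1r quotK.
have gw1 : mulLp g w1 = mulLp k v.
  apply: rep_ext.
  apply: filterS (ae_and (mulLpE w1 mg g1) (ae_and (mulLpE v mk k1) vE)) => x [-> [-> ->]].
  rewrite /k /g; have [_|bx] := boolP (b x); first by rewrite !mul0r.
  by rewrite !mul1r quotK//; move: bx; rewrite /b -ltNge => /ltW.
(* [u] and [mulLp h u] live where [b] holds, [v] and [mulLp k v] where it fails: [LD_disjoint]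
   separates the two groups and [L_addM] splits each. *)
have -> : w1 + w2 = (u + mulLp h u) + (v + mulLp k v).
  by rewrite {1}w1E {1}w2E -/u -/v fw2 gw1 [v + _]addrC addrACA.
rewrite LD_disjoint; last first.
  have e1 := ae_and (repD u (mulLp h u)) (ae_and (mulLpE u mh h1) uE).
  have e2 := ae_and (repD v (mulLp k v)) (ae_and (mulLpE v mk k1) vE).
  apply: filterS (ae_and e1 e2) => x [[-> [-> ->]] [-> [-> ->]]].
  by rewrite /h /k /f /g; case: (b x); rewrite !(mul0r, mulr0, addr0).
by rewrite !L_addM// Lw1 Lw2 -/u -/v fw2 gw1; ring.
Qed.

End DisjointAdditivity.

(** * The limit isometry and the first-order comparison *)

Lemma half_addB (R : realType) (V : lmodType R) (s t z : V) :
  2^-1 *: (s + t) - z = 2^-1 *: ((s - z) + (t - z)).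
Proof.
rewrite addrACA -opprD [RHS]scalerDr scalerN -[z + z]mulr2n -[z *+ 2]scaler_nat scalerA.
by rewrite mulVf// scale1r.
Qed.

Section LimitIsometry.
Context (R : realType) (p : R) (p1 : 1 < p).
Context d1 (T1 : measurableType d1) (mu1 : {measure set T1 -> \bar R}).
Context d2 (T2 : measurableType d2) (mu2 : {measure set T2 -> \bar R}).
Notation X1 := (Lp mu1 p1).
Notation X2 := (Lp mu2 p1).
Let p0 : 0 < p. Proof. exact: lt_trans p1. Qed.

(** The convexity defect is nonpositive here, so [Lp_cvx_defect] gives |u - v|^p <= 2 t r^p for
    every t > 0. *)
Lemma Lp_strict_convex d (T : measurableType d) (mu : {measure set T -> \bar R})
    (u v : Lp mu p1) (r : R) :
  `|u| <= r -> `|v| <= r -> r <= `|2^-1 *: (u + v)| -> u = v.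
Proof.
move=> ur vr ruv; have r0 : 0 <= r := le_trans (normr_ge0 _) ur.
have powle (a b : R) : 0 <= a -> a <= b -> a `^ p <= b `^ p.
  by move=> a0 ab; rewrite ge0_ler_powR ?nnegrE ?(ltW p0)// (le_trans a0).
have rp0 := powR_ge0 r p.
have : `|u - v| `^ p <= 0.
  apply: (@ler_epsM _ _ _ (2 * r `^ p)); first by rewrite mulr_ge0.
  move=> e e0; have [K K0 HK] := Lp_cvx_defect mu p1 e0.
  apply: le_trans (HK u v) _; rewrite add0r.
  have h1 := powle _ _ (normr_ge0 u) ur; have h2 := powle _ _ (normr_ge0 v) vr.
  have h3 := powle _ _ r0 ruv.
  have h4 : K * ((`|u| `^ p + `|v| `^ p) / 2 - `|2^-1 *: (u + v)| `^ p) <= 0.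
    by rewrite mulr_ge0_le0//; lra.
  have h5 : e * (`|u| `^ p + `|v| `^ p) <= e * (2 * r `^ p) by rewrite ler_pM2l//; lra.
  by rewrite [_ * e]mulrC; apply: le_trans (lerD h5 h4) _; rewrite addr0.
move=> h; apply/eqP; rewrite -subr_eq0 -normr_eq0.
have /eqP : `|u - v| `^ p = 0 by apply/eqP; rewrite eq_le h powR_ge0.
by rewrite powR_eq0 => /andP[].
Qed.

(** The midpoint of [w] and [w'] is within [b] of [y], hence at least [a] away from [x]; strict
    convexity applies to w - x and w' - x. *)
Lemma between_unique d (T : measurableType d) (mu : {measure set T -> \bar R})
    (x y w w' : Lp mu p1) (a b : R) : a + b <= `|x - y| ->
  `|w - x| <= a -> `|w - y| <= b -> `|w' - x| <= a -> `|w' - y| <= b -> w = w'.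
Proof.
move=> xy wx wy w'x w'y; apply/eqP; rewrite -(inj_eq (addIr (- x))); apply/eqP.
apply: (Lp_strict_convex wx w'x).
have half (c : R) (s t : Lp mu p1) z : `|s - z| <= c -> `|t - z| <= c ->
    `|2^-1 *: (s + t) - z| <= c.
  move=> sz tz; rewrite half_addB.
  rewrite normrZ ger0_norm// -ler_pdivlMl ?invr_gt0// invrK.
  by apply: le_trans (ler_normD _ _) _; lra.
rewrite -half_addB.
have h1 := half _ _ _ _ wy w'y.
have h2 : `|x - y| <= `|2^-1 *: (w + w') - x| + `|2^-1 *: (w + w') - y|.
  by rewrite [X in _ <= X + _]distrC -{1}(subrKA (2^-1 *: (w + w')) x) ler_normD.
by lra.
Qed.

Lemma invn_small (C e : R) : 0 <= C -> 0 < e ->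
  exists N, forall n, (N <= n)%N -> C / n.+1%:R <= e.
Proof.
move=> C0 e0; exists (Num.truncn (C / e)) => n nN.
rewrite ler_pdivrMr// -ler_pdivrMl// mulrC.
have /andP[_ h] := truncn_itv (divr_ge0 C0 (ltW e0)); apply: ltW.
by apply: lt_le_trans h _; rewrite ler_nat ltnS.
Qed.

Lemma isometry_linear (U : X1 -> X2) : U 0 = 0 ->
  (forall x y, `|U x - U y| = `|x - y|) ->
  {morph U : x y / x + y} /\ (forall a x, U (a *: x) = a *: U x).
Proof.
move=> U0 Uiso.
have Un x : `|U x| = `|x| by rewrite -[U x]subr0 -U0 Uiso subr0.
have Z01 t x : 0 <= t -> t <= 1 -> U (t *: x) = t *: U x.
  move=> t0 t1; apply: (@between_unique _ _ _ (U 0) (U x) _ _ (t * `|x|) ((1 - t) * `|x|)).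
  - by rewrite Uiso sub0r normrN -mulrDl addrC subrK mul1r.
  - by rewrite Uiso subr0 normrZ ger0_norm.
  - rewrite Uiso -{2}(scale1r x) -scalerBl normrZ distrC ger0_norm// subr_ge0//.
  - by rewrite U0 subr0 normrZ ger0_norm// Un.
  - rewrite -{2}(scale1r (U x)) -scalerBl normrZ distrC ger0_norm ?subr_ge0// Un//.
have halfI (V : normedModType R) (x y : V) : `|2^-1 *: (x + y) - x| = 2^-1 * `|x - y|.
  rewrite half_addB subrr add0r.
  by rewrite normrZ ger0_norm// distrC.
have D x y : U (x + y) = U x + U y.
  have mid : U (2^-1 *: (x + y)) = 2^-1 *: (U x + U y).
    have h : 2^-1 + 2^-1 = 1 :> R by field.
    apply: (@between_unique _ _ _ (U x) (U y) _ _ (2^-1 * `|x - y|) (2^-1 * `|x - y|)).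
    - by rewrite -mulrDl h mul1r Uiso.
    - by rewrite Uiso halfI.
    - by rewrite Uiso [x + y]addrC halfI distrC.
    - by rewrite halfI Uiso.
    - by rewrite [U x + U y]addrC halfI distrC Uiso.
  apply: (@scalerI _ _ 2^-1 (lt0r_neq0 _)); first by rewrite invr_gt0.
  by rewrite -mid Z01// ?invr_ge0// invf_le1// ler1n.
split=> //.
have N x : U (- x) = - U x.
  by apply/eqP; rewrite -subr_eq0 opprK -D addNr U0.
have Zpos t x : 0 <= t -> U (t *: x) = t *: U x.
  move=> t0; have [|t1] := leP t 1; first exact: Z01.
  have tn0 : t != 0 by rewrite gt_eqF// (lt_trans _ t1).
  have -> : U x = t^-1 *: U (t *: x).
    by rewrite -Z01 ?invr_ge0 ?scalerK// invf_le1 ?(ltW t1)// (lt_trans _ t1).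
  by rewrite scalerA mulfV// scale1r.
move=> a x; have [a0|a0] := leP 0 a; first exact: Zpos.
have := Zpos (- a) x; rewrite oppr_ge0 (ltW a0) !scaleNr N => /(_ isT).
exact: oppr_inj.
Qed.

Context (eps : R) (f : X1 -> X2) (eps_ge0 : 0 <= eps).
Context (f_near : nearisometry eps f).
Context (f0 : f 0 = 0).

Lemma near_le x y : `|f x - f y| <= `|x - y| + eps.
Proof. by have := f_near x y; rewrite ler_norml => /andP[_]; rewrite lerBlDl. Qed.

Lemma near_ge x y : `|x - y| - eps <= `|f x - f y|.
Proof. by have := f_near x y; rewrite ler_norml => /andP[h _]; lra. Qed.

Lemma near_norm_le x : `|f x| <= `|x| + eps.
Proof. by have := near_le x 0; rewrite f0 !subr0. Qed.

Lemma near_norm_ge x : `|x| - eps <= `|f x|.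
Proof. by have := near_ge x 0; rewrite f0 !subr0. Qed.

Definition rescale x (n : nat) : X2 := n.+1%:R^-1 *: f (n.+1%:R *: x).

Lemma norm_rescale_le x n : `|rescale x n| <= `|x| + eps / n.+1%:R.
Proof.
rewrite normrZ ger0_norm ?invr_ge0// -ler_pdivlMl ?invr_gt0// invrK.
rewrite mulrDr mulrCA mulfV// mulr1.
by have := near_norm_le (n.+1%:R *: x); rewrite normrZ ger0_norm.
Qed.

(** With a = m + 1 <= b = n + 1, the sum is written through f(bx) and the increment f(bx) - f(ax):
    in (1/a + 1/b)(b|x| - eps) - (1/a)((b - a)|x| + eps) the multiples b/a of |x| cancel and leave
    2|x|. *)
Lemma norm_rescaleD_ge x m n : (m <= n)%N ->
  2 * `|x| - 3 * eps / m.+1%:R <= `|rescale x m + rescale x n|.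
Proof.
move=> mn; rewrite /rescale.
have [a0 b0] : 0 < m.+1%:R :> R /\ 0 < n.+1%:R :> R by rewrite !ltr0n.
have : m.+1%:R <= n.+1%:R :> R by rewrite ler_nat.
move: (m.+1%:R : R) (n.+1%:R : R) a0 b0 => a b a0 b0 ab.
have fb := near_norm_ge (b *: x); have fab := near_le (b *: x) (a *: x).
rewrite normrZ (gtr0_norm b0) in fb.
rewrite -scalerBl normrZ ger0_norm ?subr_ge0// in fab.
have -> : a^-1 *: f (a *: x) + b^-1 *: f (b *: x) =
    (a^-1 + b^-1) *: f (b *: x) - a^-1 *: (f (b *: x) - f (a *: x)).
  rewrite scalerDl scalerBr opprB; set P := a^-1 *: f (a *: x).
  set Q := b^-1 *: f (b *: x); set S := a^-1 *: f (b *: x).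
  by rewrite [S + Q]addrC addrACA subrr addr0 addrC.
apply: le_trans (lerB_dist _ _).
rewrite !normrZ !ger0_norm ?addr_ge0 ?invr_ge0 ?(ltW a0) ?(ltW b0)//.
have ba : b^-1 <= a^-1 by rewrite lef_pV2.
have h1 : (a^-1 + b^-1) * (b * `|x| - eps) <= (a^-1 + b^-1) * `|f (b *: x)|.
  by rewrite ler_wpM2l// addr_ge0// invr_ge0 ltW.
have h2 : a^-1 * `|f (b *: x) - f (a *: x)| <= a^-1 * ((b - a) * `|x| + eps).
  by rewrite ler_wpM2l// invr_ge0 ltW.
apply: le_trans (lerB h1 h2).
have -> : (a^-1 + b^-1) * (b * `|x| - eps) - a^-1 * ((b - a) * `|x| + eps) =
   2 * `|x| - 2 * eps / a - eps * b^-1 by field; rewrite !gt_eqF.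
have h3 : eps * b^-1 <= eps * a^-1 by rewrite ler_wpM2l.
have -> : 3 * eps / a = 2 * eps / a + eps * a^-1 by field; rewrite gt_eqF.
by lra.
Qed.

Lemma rescale_cauchy x : norm_cauchy (rescale x).
Proof.
apply: (@unif_convex_cauchy _ _ _ _ _ _ _ `|x|) => // e e0.
have [N HN] := invn_small (mulr_ge0 (ler0n _ 3) eps_ge0) e0.
exists N => m n Nm Nn; split.
  apply: le_trans (norm_rescale_le x n) _; rewrite lerD2l; apply: le_trans (HN n Nn).
  by rewrite ler_wpM2r ?invr_ge0// ler_peMl// ler1n.
have [mn|/ltnW nm] := leqP m n.
  by apply: le_trans (norm_rescaleD_ge x mn); rewrite lerB// HN.
by rewrite [rescale x m + _]addrC; apply: le_trans (norm_rescaleD_ge x nm); rewrite lerB// HN.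
Qed.

Theorem limit_isometry : exists U : X1 -> X2,
  [/\ {morph U : x y / x + y}, (forall a x, U (a *: x) = a *: U x),
      (forall x, `|U x| = `|x|) & (forall x, tends_to (rescale x) (U x))].
Proof.
have /choice[U HU] x : exists l, tends_to (rescale x) l.
  exact/Lp_complete/rescale_cauchy.
have U0 : U 0 = 0.
  apply/eqP; rewrite -normr_le0; apply/ler_addgt0Pr => e e0; rewrite add0r.
  have [N HN] := HU 0 e e0; have := HN N (leqnn _).
  by rewrite /rescale scaler0 f0 scaler0 sub0r normrN.
have Uiso x y : `|U x - U y| = `|x - y|.
  have Uxy (e : R) : 0 < e -> `| `|U x - U y| - `|x - y| | <= 0 + 3 * e.
    move=> e0; have [N1 HN1] := HU x e e0; have [N2 HN2] := HU y e e0.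
    have [N3 HN3] := invn_small eps_ge0 e0.
    pose n := (N1 + N2 + N3)%N.
    have h1 : `|rescale x n - U x| <= e by apply: HN1; rewrite /n -addnA leq_addr.
    have h2 : `|rescale y n - U y| <= e by apply: HN2; rewrite /n addnAC leq_addl.
    have h3 : eps / n.+1%:R <= e by apply: HN3; rewrite leq_addl.
    have h4 : `| `|rescale x n - rescale y n| - `|x - y| | <= e.
      apply: le_trans h3; rewrite /rescale -scalerBr normrZ [`|_^-1|]ger0_norm ?invr_ge0//.
      have := f_near (n.+1%:R *: x) (n.+1%:R *: y).
      rewrite -scalerBr normrZ [`|n.+1%:R|]ger0_norm//.
      move: (ltr0Sn R n); move: (n.+1%:R : R) => N N0 h.
      rewrite ler_pdivlMr// mulrC -{1}(gtr0_norm N0) -normrM mulrBr mulrA mulfV ?gt_eqF//.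
      by rewrite mul1r.
    have h5 : `| `|U x - U y| - `|rescale x n - rescale y n| | <= 2 * e.
      apply: le_trans (ler_dist_dist _ _) _.
      have -> : U x - U y - (rescale x n - rescale y n) =
          (rescale y n - U y) - (rescale x n - U x).
        by rewrite !opprB [LHS]addrACA [RHS]addrACA; congr (_ + _); exact: addrC.
      by apply: le_trans (ler_normB _ _) _; lra.
    rewrite add0r; move: h4 h5; rewrite !ler_norml => /andP[? ?] /andP[? ?].
    by apply/andP; split; lra.
  apply/eqP; rewrite -subr_eq0 -normr_le0.
  exact: (@ler_epsM _ _ _ 3).
have [UD UZ] := isometry_linear U0 Uiso.
exists U; split=> // x.
by rewrite -[U x]subr0 -U0 Uiso subr0.
Qed.

Context (q : R) (q1 : 1 < q) (pq : p^-1 + q^-1 = 1).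

Lemma tends_to_dmap d (T : measurableType d) (mu : {measure set T -> \bar R})
    (u : nat -> Lp mu p1) l : tends_to u l ->
  tends_to (fun n => dmap q1 (u n)) (dmap q1 l).
Proof.
move=> ul e e0; have [s s0 Hs] := dmap_continuous q1 pq l e0.
have [N HN] := ul s s0; exists N => n Nn; rewrite distrC; apply: Hs.
by rewrite distrC HN.
Qed.

Lemma tends_to_norm (X : normedModType R) (u : nat -> X) l : tends_to u l ->
  `|u n| @[n --> \oo] --> `|l|.
Proof.
move=> ul; apply/cvgrPdist_le => e e0; have [N HN] := ul e e0.
exists N => // n /= Nn; apply: le_trans (ler_dist_dist _ _) _.
by rewrite distrC HN.
Qed.

Lemma tends_to_pairing d (T : measurableType d) (mu : {measure set T -> \bar R})
    (u : nat -> Lp mu q1) l (y : Lp mu p1) : tends_to u l ->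
  pairing (u n) y @[n --> \oo] --> pairing l y.
Proof.
move=> ul; apply/cvgrPdist_le => e e0.
have y0 : 0 < `|y| + 1 by rewrite ltr_wpDl.
have [N HN] := ul _ (divr_gt0 e0 y0).
exists N => // n /= Nn; rewrite -(pairingBl pq).
apply: le_trans (pairing_le pq _ _) _.
apply: (@le_trans _ _ (e / (`|y| + 1) * `|y|)); first by rewrite ler_wpM2r// distrC HN.
by rewrite mulrAC ler_pdivrMr// ler_pM2l// lerDl.
Qed.

(* Compare [|f (n u) - f x|] with [|n u - x|]: up to [o(1)] the latter is
   [n |u|] minus the support functional of [u] at [x], while the former is at least
   [n |u| - eps] minus the support functional of [U u] at [f x]. *)
Lemma near_pairing_le (U : X1 -> X2) : (forall x, `|U x| = `|x|) ->
  (forall x, tends_to (rescale x) (U x)) -> forall u x,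
  pairing (dmap q1 u) x - pairing (dmap q1 (U u)) (f x) <= 2 * eps * `|u| `^ (p - 1).
Proof.
move=> Un Ulim u x.
have arith (a b c s t : R) : b - c <= a * t + a * eps -> a * s - a * eps <= b ->
  a * s - a * t - a * (2 * eps) <= c by lra.
have p10 : 0 < p - 1 by rewrite subr_gt0.
have [->|u0] := eqVneq u 0.
  have U0 : U 0 = 0 by apply/normr0_eq0; rewrite Un normr0.
  have d0 d (T : measurableType d) (mu : {measure set T -> \bar R}) :
      dmap q1 (0 : Lp mu p1) = 0.
    by rewrite -(scale0r (0 : Lp mu p1)) (dmapZ q1 pq) spow0 scale0r.
  have pr0 d (T : measurableType d) (mu : {measure set T -> \bar R}) (y : Lp mu p1) :
      pairing (0 : Lp mu q1) y = 0.
    by rewrite -(scale0r (0 : Lp mu q1)) (pairingZl pq) mul0r.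
  by rewrite U0 !d0 !pr0 subr0 mulr_ge0 ?powR_ge0// mulr_ge0.
(* Scaled by n + 1, [z n] is (n + 1) u - x and [g n] is f((n + 1) u). *)
pose z n := u - n.+1%:R^-1 *: x.
pose g n := rescale u n.
have zu : tends_to z u.
  move=> e e0; have [N HN] := invn_small (normr_ge0 x) e0; exists N => n Nn.
  rewrite /z addrAC subrr add0r normrN normrZ ger0_norm ?invr_ge0// mulrC.
  exact: HN.
pose A := `|u| `^ (p - 1).
have A0 : 0 < A by rewrite powR_gt0// normr_gt0.
(* [hz] bounds <Jz, x> above and [hg] bounds <Jg, f x> below through the same quantity (n + 1)(|u| -
   |z n|); cross-multiplying by the powers of the norms eliminates it before the limit. One [eps] in
   [hg] comes from |f((n + 1) u) - f x|, the other from |f((n + 1) u)|. *)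
have step n : `|g n| `^ (p - 1) * pairing (dmap q1 (z n)) x -
    2 * eps * (`|z n| `^ (p - 1) * `|g n| `^ (p - 1)) <=
    `|z n| `^ (p - 1) * pairing (dmap q1 (g n)) (f x).
  have N0 := ltr0Sn R n.
  have hz : pairing (dmap q1 (z n)) x <= `|z n| `^ (p - 1) * (n.+1%:R * (`|u| - `|z n|)).
    have : `|z n| `^ p + n.+1%:R^-1 * pairing (dmap q1 (z n)) x <= `|z n| `^ (p - 1) * `|u|.
      rewrite -(pairing_dmap q1 pq) -(pairingZr pq) -(pairingDr pq) /z subrK -/(z n).
      apply: le_trans (ler_norm _) _; apply: le_trans (pairing_le pq _ _) _.
      by rewrite (norm_dmap q1 pq).
    rewrite -lerBrDl -(mulr_powRB1 (normr_ge0 _) p0) [`|z n| * _]mulrC -mulrBr.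
    by rewrite mulrC ler_pdivrMr// mulrAC mulrA.
  have hg : `|g n| `^ (p - 1) * (n.+1%:R * (`|u| - `|z n|) - 2 * eps) <=
      pairing (dmap q1 (g n)) (f x).
    have fg : f (n.+1%:R *: u) = n.+1%:R *: g n.
      by rewrite /g /rescale scalerA mulfV ?scale1r// gt_eqF.
    have hx : `|f (n.+1%:R *: u) - f x| <= n.+1%:R * `|z n| + eps.
      apply: le_trans (near_le _ _) _; rewrite lerD2r -{2}(gtr0_norm N0) -normrZ.
      by rewrite /z scalerBr scalerA mulfV ?scale1r// gt_eqF.
    have h1 : n.+1%:R * `|g n| `^ p - pairing (dmap q1 (g n)) (f x) <=
        `|g n| `^ (p - 1) * (n.+1%:R * `|z n| + eps).
      rewrite -(pairing_dmap q1 pq) -(pairingZr pq) -(pairingBr pq) -fg.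
      apply: le_trans (ler_norm _) _; apply: le_trans (pairing_le pq _ _) _.
      by rewrite (norm_dmap q1 pq) ler_wpM2l ?powR_ge0.
    have h2 : `|g n| `^ (p - 1) * (n.+1%:R * `|u| - eps) <= n.+1%:R * `|g n| `^ p.
      rewrite -(mulr_powRB1 (normr_ge0 _) p0) mulrA [leRHS]mulrC ler_wpM2l ?powR_ge0//.
      have := near_norm_ge (n.+1%:R *: u).
      by rewrite fg !normrZ gtr0_norm.
    by rewrite !mulrBr !mulrDr in h1 h2 *; exact: arith h1 h2.
  have := ler_wpM2l (powR_ge0 `|z n| (p - 1)) hg.
  have := ler_wpM2l (powR_ge0 `|g n| (p - 1)) hz.
  move: (`|z n| `^ (p - 1)) (`|g n| `^ (p - 1)) (n.+1%:R * (`|u| - `|z n|)) => a b c h1 h2.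
  apply: le_trans h2; apply: le_trans (lerB h1 (lexx _)) _.
  by rewrite le_eqVlt; apply/orP; left; apply/eqP; ring.
have cz : `|z n| `^ (p - 1) @[n --> \oo] --> A.
  rewrite /A -(norm_dmap q1 pq); under eq_fun do rewrite -(norm_dmap q1 pq).
  exact/tends_to_norm/tends_to_dmap.
have cg : `|g n| `^ (p - 1) @[n --> \oo] --> A.
  rewrite /A -Un -(norm_dmap q1 pq); under eq_fun do rewrite -(norm_dmap q1 pq).
  exact/tends_to_norm/tends_to_dmap/Ulim.
have cpz := tends_to_pairing (y := x) (tends_to_dmap zu).
have cpg := tends_to_pairing (y := f x) (tends_to_dmap (Ulim u)).
have cl : `|g n| `^ (p - 1) * pairing (dmap q1 (z n)) x -
    2 * eps * (`|z n| `^ (p - 1) * `|g n| `^ (p - 1)) @[n --> \oo] -->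
    A * pairing (dmap q1 u) x - 2 * eps * (A * A).
  by apply: cvgB; apply: cvgM => //; [exact: cvg_cst|exact: cvgM].
have cr : `|z n| `^ (p - 1) * pairing (dmap q1 (g n)) (f x) @[n --> \oo] -->
    A * pairing (dmap q1 (U u)) (f x) by exact: cvgM.
have : A * pairing (dmap q1 u) x - 2 * eps * (A * A) <= A * pairing (dmap q1 (U u)) (f x).
  by apply: (ler_cvg_to cl cr); apply: nearW => n; exact: step.
have -> : 2 * eps * (A * A) = A * (2 * eps * A) by ring.
by rewrite -mulrBr ler_pM2l// !lerBlDr addrC.
Qed.

End LimitIsometry.

(** * The operator adjoint to the isometry *)

Section Projection.
Context (R : realType) (p : R) (p1 : 1 < p) (q : R) (q1 : 1 < q).
Context (pq : p^-1 + q^-1 = 1).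
Context d1 (T1 : measurableType d1) (mu1 : {measure set T1 -> \bar R}).
Context d2 (T2 : measurableType d2) (mu2 : {measure set T2 -> \bar R}).
Notation X1 := (Lp mu1 p1).
Notation X2 := (Lp mu2 p1).
Let p0 : 0 < p. Proof. exact: lt_trans p1. Qed.
Let q0 : 0 < q. Proof. exact: lt_trans q1. Qed.
Let qp : q^-1 + p^-1 = 1. Proof. by rewrite addrC. Qed.

Lemma pairingC d (T : measurableType d) (mu : {measure set T -> \bar R})
  (w : Lp mu q1) (u : Lp mu p1) : pairing w u = pairing u w.
Proof. by rewrite pairing.unlock; apply: eq_Rintegral => x _; rewrite mulrC. Qed.

(** Since <Ju, u> = |u|^(p-1) |u|, the power cancels. Both the contractivity of the operator and the
    final estimate are obtained in this form. *)
Lemma norm_le_dmap d (T : measurableType d) (mu : {measure set T -> \bar R})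
    (u : Lp mu p1) (M : R) : 0 <= M ->
  pairing (dmap q1 u) u <= `|u| `^ (p - 1) * M -> `|u| <= M.
Proof.
move=> M0; have [->|u0] := eqVneq u 0; first by rewrite normr0.
have A0 : 0 < `|u| `^ (p - 1) by rewrite powR_gt0// normr_gt0.
by rewrite (pairing_dmap q1 pq) -(mulr_powRB1 (normr_ge0 _) p0) mulrC ler_pM2l.
Qed.

(** Testing with u = z - z' gives |z - z'|^p = 0. *)
Lemma dmap_separates d (T : measurableType d) (mu : {measure set T -> \bar R})
    (z z' : Lp mu p1) :
  (forall u : Lp mu p1, pairing (dmap q1 u) z = pairing (dmap q1 u) z') -> z = z'.
Proof.
move=> H; apply/eqP; rewrite -subr_eq0 -normr_le0; apply: norm_le_dmap => //.
by rewrite mulr0 (pairingBr pq) H subrr.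
Qed.

Context (U : X1 -> X2) (UD : {morph U : x y / x + y}).
Context (UZ : forall a x, U (a *: x) = a *: U x) (Un : forall x, `|U x| = `|x|).

Let UB x y : U (x - y) = U x - U y.
Proof. by rewrite UD -[- y]scaleN1r UZ scaleN1r. Qed.

(* [w |-> <J U J^-1 w, y>] with [J] the duality maps. *)
Definition transfer (y : X2) (w : Lp mu1 q1) : R :=
  pairing (dmap q1 (U (dmap p1 w))) y.

Lemma conj_exponentV : (q - 1) * (p - 1) = 1.
Proof.
have h : (p - 1) * q = p by apply: conj_exponentE => //; rewrite gt_eqF.
by rewrite mulrC mulrBr h; lra.
Qed.

(** A scalar leaves J^-1 as its signed power q - 1, and [J] undoes this because (q - 1)(p - 1) =
    1. *)
Lemma transferZ y a w : transfer y (a *: w) = a * transfer y w.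
Proof.
rewrite /transfer (dmapZ p1 qp) UZ (dmapZ q1 pq) (pairingZl pq).
by rewrite spowK ?subr_gt0// conj_exponentV.
Qed.

Lemma transfer_le y w : `|transfer y w| <= `|y| * `|w|.
Proof.
apply: le_trans (pairing_le pq _ _) _; rewrite mulrC.
rewrite (norm_dmap q1 pq) Un (norm_dmap p1 qp) -powRrM conj_exponentV.
by rewrite powRr1.
Qed.

Lemma transfer_continuous y w (e : R) : 0 < e ->
  exists2 s : R, 0 < s & forall v, `|w - v| <= s -> `|transfer y w - transfer y v| <= e.
Proof.
move=> e0; have y0 : 0 < `|y| + 1 by rewrite ltr_wpDl.
have [s s0 Hs] := dmap_continuous q1 pq (U (dmap p1 w)) (divr_gt0 e0 y0).
have [r r0 Hr] := dmap_continuous p1 qp w s0.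
exists r => // v /Hr wv; rewrite /transfer -(pairingBl pq).
apply: le_trans (pairing_le pq _ _) _.
apply: (@le_trans _ _ (e / (`|y| + 1) * `|y|)).
  by rewrite ler_wpM2r// Hs// -UB Un.
by rewrite mulrAC ler_pdivrMr// ler_pM2l// lerDl.
Qed.

(** J^-1 and [U] both preserve disjointness, and the two duality maps are additive on disjoint
    sums. *)
Lemma transferD_disjoint y v w : p != 2 -> disjointLp v w ->
  transfer y (v + w) = transfer y v + transfer y w.
Proof.
move=> p2 vw; rewrite /transfer (dmapD_disjoint p1 qp vw) UD -(pairingDl pq).
rewrite (dmapD_disjoint q1 pq)//; apply: (isometry_disjoint p2 UD Un).
apply: filterS (ae_and vw (ae_and (dmapE p1 qp v) (dmapE p1 qp w))) => x [h [-> ->]].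
by rewrite -spowM h spow0.
Qed.

Lemma transferD y : {morph transfer y : v w / v + w}.
Proof.
have [p2|p2] := eqVneq p 2.
  move=> v w; have q2 : q = 2.
    have h := @conj_exponentE _ p q; rewrite !gt_eqF// in h.
    by have := h isT isT pq; rewrite p2; lra.
  by rewrite /transfer (dmapD2 p1 qp)// UD (dmapD2 q1 pq)// (pairingDl pq).
apply: disjoint_additive.
- exact: transferZ.
- by move=> v w; exact: transferD_disjoint.
- exact: transfer_continuous.
Qed.

Lemma dmapN d (T : measurableType d) (mu : {measure set T -> \bar R}) (u : Lp mu p1) :
  dmap q1 (- u) = - dmap q1 u.
Proof.
rewrite -scaleN1r (dmapZ q1 pq) spowN ge0_spow ?subr_gt0// onepowR.
by rewrite scaleN1r.
Qed.

(* A linear isometry is a [0]-nearisometry equal to its own rescalings. *)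
Lemma isometry_pairing u x : pairing (dmap q1 (U u)) (U x) = pairing (dmap q1 u) x.
Proof.
have U0 : U 0 = 0 by apply/normr0_eq0; rewrite Un normr0.
have Unear : nearisometry 0 U by move=> v w; rewrite -UB Un subrr normr0.
have Ulim v : tends_to (rescale U v) (U v).
  move=> e e0; exists 0%N => n _.
  by rewrite /rescale UZ scalerA mulVf ?scale1r ?subrr ?normr0 ?ltW// gt_eqF.
have UN v : U (- v) = - U v by rewrite -scaleN1r UZ scaleN1r.
have le v := near_pairing_le (lexx (0 : R)) Unear U0 q1 pq Un Ulim v x.
apply/eqP; rewrite eq_le; apply/andP; split; last first.
  by have := le u; rewrite mulr0 mul0r subr_le0.
(* [near_pairing_le] is one-sided; -u gives the reverse inequality. *)
have := le (- u); rewrite UN !dmapN !(pairingNl pq) mulr0 mul0r subr_le0.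
by rewrite lerN2.
Qed.

(** The Riesz theorem is used with [p] and [q] exchanged, so the representing element lies in L^p;
    it is then evaluated at w = Ju, where J^-1 J = id. *)
Theorem isometry_adjoint : exists S : X2 -> X1, forall u y,
  pairing (dmap q1 u) (S y) = pairing (dmap q1 (U u)) y.
Proof.
have /choice[S HS] y : exists z : X1, forall w, transfer y w = pairing z w.
  exact: (Lp_riesz p1 qp (transferD y) (transferZ y) (transfer_le y)).
exists S => u y; rewrite pairingC -HS /transfer.
by rewrite (dmapK q1 pq).
Qed.

End Projection.

(** * Conclusion: the contraction and its estimate *)

Lemma contraction_continuous (R : realType) (X Y : normedModType R)
  (S : {linear X -> Y}) : (forall x, `|S x| <= `|x|) -> continuous S.
Proof.
move=> S1 x; apply/cvgrPdist_le => e e0; near=> y.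
rewrite -linearB; apply: le_trans (S1 _) _.
by near: y; exact: cvgr_dist_le.
Unshelve. all: by end_near. Qed.

Unset Implicit Arguments.

Theorem theorem2p4 (R : realType)
    (d1 : measure_display) (Omega1 : measurableType d1)
    (mu1 : {measure set Omega1 -> \bar R})
    (d2 : measure_display) (Omega2 : measurableType d2)
    (mu2 : {measure set Omega2 -> \bar R})
    (p : R) (p1 : 1 < p)
    (X1_neq0 : exists x : Lp mu1 p1, x != 0)
    (eps : R) (eps_ge0 : 0 <= eps)
    (f : Lp mu1 p1 -> Lp mu2 p1)
    (f_near : nearisometry eps f) (f0 : f 0 = 0) :
  exists T : {linear Lp mu2 p1 -> Lp mu1 p1},
    [/\ continuous T, opnorm T = 1 &
        forall x : Lp mu1 p1, `|T (f x) - x| <= 2 * eps].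
Proof.
pose q := p / (p - 1).
have p0 : 0 < p by exact: (lt_trans ltr01 p1).
have p10 : 0 < p - 1 by rewrite subr_gt0.
have q1 : 1 < q by rewrite ltr_pdivlMr// mul1r ltrBlDr ltrDl.
have pq : p^-1 + q^-1 = 1.
  by rewrite /q invf_div -{1}(div1r p) -mulrDl subrKC mulfV// gt_eqF.
have [U [UD UZ Un Ulim]] := limit_isometry eps_ge0 f_near f0.
have [S HS] := isometry_adjoint q1 pq UD UZ Un.
(* Every <Ju, S .> is linear in its argument, and the functionals <Ju, .> separate points. *)
have Slin (a : R) (y z : Lp mu2 p1) : S (a *: y + z) = a *: S y + S z.
  apply: (dmap_separates (q1 := q1) pq) => u.
  by rewrite HS !(pairingDr pq) !(pairingZr pq) !HS.
pose T : {linear Lp mu2 p1 -> Lp mu1 p1} :=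
  HB.pack S (GRing.isLinear.Build R (Lp mu2 p1) (Lp mu1 p1) _ S Slin).
(* |Sy|^p = <J(U S y), y> <= |Sy|^(p-1) |y|. *)
have Sle y : `|S y| <= `|y|.
  apply: (norm_le_dmap (q1 := q1) pq) => //; rewrite HS.
  apply: le_trans (ler_norm _) _; apply: le_trans (pairing_le pq _ _) _.
  by rewrite (norm_dmap q1 pq) Un.
have SU x : S (U x) = x.
  apply: (dmap_separates (q1 := q1) pq) => u; rewrite HS.
  exact: (isometry_pairing q1 pq UD UZ Un).
exists T; split.
- exact: (@contraction_continuous R (Lp mu2 p1) (Lp mu1 p1) T Sle).
(* The value 1 is attained at [U] of a normalised nonzero vector, since S U = id. *)
- have [x0 x0n] := X1_neq0.
  have nx0 : 0 < `|x0| by rewrite normr_gt0.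
  pose E := [set `|S y| | y in [set y : Lp mu2 p1 | `|y| <= 1]].
  have Eub : ubound E 1 by move=> _ [y /= y1 <-]; exact: le_trans (Sle y) y1.
  have E1 : E 1.
    have n1 : `| `|x0|^-1 *: x0| = 1.
      by rewrite normrZ ger0_norm ?invr_ge0// mulVf// gt_eqF.
    by exists (U (`|x0|^-1 *: x0)) => /=; rewrite ?SU ?Un n1.
  apply/eqP; rewrite eq_le; apply/andP; split.
    by apply: ge_sup => //; exists 1.
  by apply: sup_upper_bound => //; split; exists 1.
- move=> x; apply: (norm_le_dmap (q1 := q1) pq); first by rewrite mulr_ge0.
  set u := S (f x) - x.
  rewrite {2}/u (pairingBr pq) HS mulrC.
  (* Taken at -u: the lemma bounds <Ju, x> - <J(Uu), f x>, and the opposite difference is wanted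
     here. *)
  have := near_pairing_le eps_ge0 f_near f0 q1 pq Un Ulim (- u) x.
  have -> : U (- u) = - U u by rewrite -scaleN1r UZ scaleN1r.
  by rewrite !(dmapN q1 pq) !(pairingNl pq) normrN opprK addrC.
Qed.
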